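(* Let $n\ge 2$, $d\ge 3$, and let $H=V(f)\subset\mathbb{P}^n_{\mathbb{C}}$ be a singular hypersurface of degree $d$. Let $s=\dim H_{\mathrm{sing}}$ and let $\delta$ be the maximal multiplicity of $H$ at a point of $H$. (1) Suppose $s\le n-2$. If $\delta<\frac{d(d-2)}{(s+2)d-(s+3)}$ then $H$ is stable; if $\delta\le\frac{d(d-2)}{(s+2)d-(s+3)}$ then $H$ is semi-stable. (2) Suppose $s=n-1$. If $\delta<\frac{d}{n+1}$ then $H$ is stable; if $\delta\le \frac{d}{n+1}$ then $H$ is semi-stable. (Equivalently, in case (1): $d>\frac{\delta(s+2)}{2}+\sqrt{(\frac{\delta(s+2)}{2})^2-\delta+1}+1$ implies stable and $\ge$ implies semi-stable; in case (2): $d>\delta(n+1)$ implies stable and $d\ge\delta(n+1)$ implies semi-stable.)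
   Context: $V=\mathbb{C}[x_0,\dots,x_n]_d$ is the space of degree $d$ homogeneous polynomials; $\mathrm{SL}(n+1)$ acts on $\mathbb{P}(V)$ by linear change of coordinates. A hypersurface $H=V(f)$, $f\in V\setminus\{0\}$, is called stable (resp. semi-stable) if $[f]\in\mathbb{P}(V)$ is GIT stable (resp. semi-stable) for this action with respect to $\mathcal{O}(1)$. The multiplicity of $H$ at a point $p$ is the order of vanishing of $f$ at $p$ (the lowest degree of a nonzero homogeneous component of a local affine equation of $H$ centered at $p$). $H_{\mathrm{sing}}$ is the singular locus of $H$. *)

(* Defs.v *)
From mathcomp Require Import all_boot all_algebra.
From mathcomp Require Import reals.
From mathcomp Require Export complex.
From mathcomp Require Export mpoly.
Import GRing.Theory Num.Theory.

Set Implicit Arguments.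
Unset Strict Implicit.
Unset Printing Implicit Defensive.

Local Open Scope ring_scope.

Section Hypersurfaces.

Variable R : realType.
Notation C := (R[i]).
Variable n : nat. (* we work in P^n, with n.+1 homogeneous coordinates *)

Definition poly := {mpoly C[n.+1]}.
Definition vec := 'I_n.+1 -> C.

Definition in_SL (g : 'M[C]_n.+1) : Prop := \det g = 1.

Definition act (g : 'M[C]_n.+1) (f : poly) : poly :=
  comp_mpoly [tuple \sum_(j < n.+1) g i j *: 'X_j | i < n.+1] f.

Definition orbit (f : poly) : poly -> Prop :=
  fun h => exists g, in_SL g /\ h = act g f.

Definition stabilizer (f : poly) : 'M[C]_n.+1 -> Prop :=
  fun g => in_SL g /\ act g f = f.

Definition polyfun (F : poly -> C) : Prop :=
  exists (k : nat) (e : 'I_k -> 'X_{1.. n.+1}) (P : {mpoly C[k]}),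
    forall h : poly, F h = P.@[fun i => h@_(e i)].

Definition Vd (d : nat) : poly -> Prop := fun h => h \is d.-homog.

Definition zclosure (d : nat) (S : poly -> Prop) : poly -> Prop :=
  fun h => Vd d h /\
    forall F, polyfun F -> (forall g, S g -> F g = 0) -> F h = 0.

(* GIT (semi)stability of [f] in P(V) w.r.t. O(1), via the affine cone:
   semistable iff 0 is not in the orbit closure of f;
   stable iff the orbit of f is closed and the stabilizer of f is finite. *)
Definition semistable (d : nat) (f : poly) : Prop :=
  ~ zclosure d (orbit f) 0.

Definition stable (d : nat) (f : poly) : Prop :=
  (forall h, zclosure d (orbit f) h -> orbit f h) /\
  (exists s : seq 'M[C]_n.+1, forall g, stabilizer f g -> g \in s).

(* a point of P^n is represented by a nonzero vector (up to scalars) *)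
Definition nonzero (v : vec) : Prop := exists i, v i != 0.

Definition onH (f : poly) (v : vec) : Prop := nonzero v /\ f.@[v] = 0.

Definition Hsing (f : poly) (v : vec) : Prop :=
  onH f v /\ forall i : 'I_n.+1, (mderiv i f).@[v] = 0.

Definition pclosed (X : vec -> Prop) : Prop :=
  exists Fam : poly -> Prop,
    (forall p, Fam p -> exists e, p \is e.-homog) /\
    forall v, X v <-> (nonzero v /\ forall p, Fam p -> p.@[v] = 0).

Definition subsetP (X Y : vec -> Prop) : Prop := forall v, X v -> Y v.

Definition psubset (X Y : vec -> Prop) : Prop :=
  subsetP X Y /\ exists v, Y v /\ ~ X v.

Definition pirreducible (X : vec -> Prop) : Prop :=
  pclosed X /\ (exists v, X v) /\
  forall Y Z, pclosed Y -> pclosed Z -> subsetP Y X -> subsetP Z X ->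
    (forall v, X v -> Y v \/ Z v) ->
    (forall v, X v -> Y v) \/ (forall v, X v -> Z v).

Definition irr_chain (X : vec -> Prop) (k : nat) : Prop :=
  exists Z : nat -> (vec -> Prop),
    (forall i, (i <= k)%N -> pirreducible (Z i) /\ subsetP (Z i) X) /\
    (forall i, (i < k)%N -> psubset (Z i) (Z i.+1)).

Definition pdim (X : vec -> Prop) (s : nat) : Prop :=
  irr_chain X s /\ ~ irr_chain X s.+1.

(* local affine equation of H centered at the point v, in the chart
   x_i <> 0 with v normalised so that v_i = 1:  g(y) = f(v + y), y_i = 0 *)
Definition local_eq (f : poly) (v : vec) (i : 'I_n.+1) : poly :=
  comp_mpoly
    [tuple (v j / v i)%:MP + (if j == i then 0 else 'X_j) | j < n.+1] f.

Definition mult_at (f : poly) (v : vec) (i : 'I_n.+1) (m : nat) : Prop :=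
  v i != 0 /\
  (exists mo, mo \in msupp (local_eq f v i) /\ mdeg mo = m) /\
  (forall mo, mo \in msupp (local_eq f v i) -> (m <= mdeg mo)%N).

Definition max_mult (f : poly) (delta : nat) : Prop :=
  (exists v i, onH f v /\ mult_at f v i delta) /\
  (forall v i m, onH f v -> mult_at f v i m -> (m <= delta)%N).

End Hypersurfaces.

(* Main.v *)
(** Suppose [f] is not stable. If its orbit is not closed, or its stabilizer is infinite, there are
   a field [K] over C, a valuation ring [O] of [K] with residue field C, and [g] in SL([K]), not in
   SL([O]), with [g f] integral over [O] (this uses only Zorn's lemma: extension of places). The
   Cartan decomposition [g = L a U] over [O], with [a] diagonal, gives the Hilbert-Mumford
   criterion: in suitable coordinates every monomial of [f] has nonnegative weight, for weights
   [lam_0 <= ... <= lam_n] of sum zero with [lam_0 < 0], in the value group of [O]. Failure of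
   semistability makes the weights of the monomials positive.

   If [lam_k < 0], [k > s] and [lam_(n+1+s-k) + (d-1) lam_k < 0], then on the linear space
   [x_(k+1) = ... = x_n = 0] only the partial derivatives [d_j f] with [j > n+1+s-k] can be
   nonzero; they are [k-s-1] in number, so the singular locus would have dimension at least [s+1].
   Summing the resulting inequalities bounds [lam_n] by a multiple of [-lam_0], and the multiplicity
   of [f] at the point [1 : 0 : ... : 0] is then at least the stated bound. *)
From HB Require Import structures.
Require Import Defs.
From mathcomp Require Import all_boot all_order all_algebra.
From mathcomp Require Import reals boolp classical_sets functions.
From mathcomp Require Import ring_quotient perm ring lra zify.
Import Order.TTheory GRing.Theory Num.Theory.

Set Implicit Arguments.
Unset Strict Implicit.
Unset Printing Implicit Defensive.
Local Open Scope ring_scope.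

(** * Zorn, prime ideals and quotient fields *)

(** The value group of a place need not have rank one, so the weights live in an abstract ordered
    group and are only added, multiplied by natural numbers and compared. The field [K] is a residue
    field of the ring of all functions from matrices to C, modulo a prime ideal that avoids the
    functions required to stay nonzero; [g] is the image of the tautological matrix of coordinate
    functions. Since [pdim] is defined by chains of irreducible closed sets, a lower bound on a
    dimension has to exhibit a chain. It comes from homogeneous primes, each obtained from the
    previous one by adding a coordinate and enlarging, with dimension measured by the number of
    linear forms needed to leave no common projective zero. Origin of the constants: with
    $c=(d-1)(s+1)$ and $e=d-2$ the weights satisfy $e\lambda_n\le -c\lambda_0$, so a monomial of
    $x_0$-degree $m_0$ has $em_0\le c(d-m_0)$; if $d-m_0\le\delta$ this gives $de\le\delta(c+e)$,
    and $c+e=(s+2)d-(s+3)$. *)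

Lemma real_uncountable (R : realType) (u : nat -> R) : exists x, forall k, x != u k.
Proof.
have step (I : R * R) (y : R) : I.1 < I.2 ->
    exists J : R * R, [/\ J.1 < J.2, I.1 <= J.1, J.2 <= I.2 & y < J.1 \/ J.2 < y].
  case: I => a b /= ab.
  have [yc|cy] := ltP y ((a + b) / 2).
    by exists ((a + b) / 2, b); split => /=; [lra|lra|lra|left; lra].
  exists (a, (3 * a + b) / 4); split => /=; [lra|lra|lra|right; lra].
have [nxt nxtP] : exists nxt : R * R -> R -> R * R, forall I y, I.1 < I.2 ->
    [/\ (nxt I y).1 < (nxt I y).2, I.1 <= (nxt I y).1, (nxt I y).2 <= I.2
      & y < (nxt I y).1 \/ (nxt I y).2 < y].
  have /choice[f fP] : forall p : (R * R) * R, exists J : R * R, p.1.1 < p.1.2 ->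
      [/\ J.1 < J.2, p.1.1 <= J.1, J.2 <= p.1.2 & p.2 < J.1 \/ J.2 < p.2].
    move=> [I y] /=; have [II|II] := boolP (I.1 < I.2); last by exists I.
    by have [J JP] := step I y II; exists J.
  by exists (fun I y => f (I, y)) => I y /(fP (I, y)).
(* Nested intervals: [F k.+1] avoids [u k], so the supremum of the left endpoints, which lies in
   every interval, is none of the [u k]. *)
pose F := fix F k := if k is k'.+1 then nxt (F k') (u k') else (0, 1).
have Flt k : (F k).1 < (F k).2.
  by elim: k => [|k IH] /=; [exact: ltr01 | have [] := nxtP _ (u k) IH].
have F1 k m : (k <= m)%N -> (F k).1 <= (F m).1.
  elim: m => [|m IH]; first by rewrite leqn0 => /eqP->.
  rewrite leq_eqVlt => /orP[/eqP->//|/IH h]; apply: (le_trans h).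
  by have [] := nxtP _ (u m) (Flt m).
have F2 k m : (k <= m)%N -> (F m).2 <= (F k).2.
  elim: m => [|m IH]; first by rewrite leqn0 => /eqP->.
  rewrite leq_eqVlt => /orP[/eqP->//|/IH h]; apply: le_trans h.
  by have [] := nxtP _ (u m) (Flt m).
have F12 k m : (F k).1 <= (F m).2.
  apply: (@le_trans _ _ (F (maxn k m)).1); first by rewrite F1 ?leq_maxl.
  by apply: (le_trans (ltW (Flt _))); rewrite F2 ?leq_maxr.
pose E := [set x | exists k, x = (F k).1]%classic.
have supE : has_sup E.
  by split; [exists (F 0%N).1; exists 0%N | exists (F 0%N).2 => x [k ->]].
exists (sup E) => k; apply/eqP => xu.
have lo : (F k.+1).1 <= sup E by apply: sup_upper_bound => //; exists k.+1.
have hi : sup E <= (F k.+1).2 by apply: ge_sup; [exact: (proj1 supE) | move=> x [m ->]].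
have [_ _ _ /=] := nxtP _ (u k) (Flt k).
by move: lo hi; rewrite /= xu => lo hi [?|?]; lra.
Qed.

(** Otherwise finite lists covering all the [A k] would combine, through [pickle], into an
    enumeration of the reals. This feeds the Nullstellensatz. *)
Lemma uncountable_cover (R : realType) (A : nat -> R -> Prop) :
  (forall x, exists k, A k x) -> exists k, forall s : seq R, exists x, A k x /\ x \notin s.
Proof.
move=> cov; apply: contrapT => /forallNP fin.
have /choice[s sP] : forall k, exists s : seq R, forall x, A k x -> x \in s.
  move=> k; have /existsNP[s sk] := fin k; exists s => x Ax.
  by apply: contrapT => /negP xs; apply: sk; exists x.
pose u m := if (unpickle m : option (nat * nat)) is Some (k, i) then nth 0 (s k) i else 0.
have [x xu] := real_uncountable u; have [k /sP xs] := cov x.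
have := xu (pickle (k, index x (s k))).
by rewrite /u pickleK nth_index ?eqxx.
Qed.

Section Zorn.
Variable T : Type.
Implicit Types (X Y : set T) (P : set T -> Prop).

(** [Zorn_bigcup] also asks about the empty chain; applying it to the sets whose union with [X0]
    satisfies [P] makes that case the hypothesis on [X0]. *)
Lemma zorn_above P X0 : P X0 ->
  (forall F : set (set T), (exists X, F X) -> (forall X, F X -> P X) ->
     (forall X Y, F X -> F Y -> (X `<=` Y)%classic \/ (Y `<=` X)%classic) ->
     P (fun x => exists X, F X /\ X x)) ->
  exists M, [/\ P M, (X0 `<=` M)%classic &
    forall Y, P Y -> (M `<=` Y)%classic -> (Y `<=` M)%classic].
Proof.
move=> PX0 chain.
have [|A [PA Amax]] := @Zorn_bigcup T (fun X => P (X `|` X0)%classic).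
  move=> F FP Ftot.
  have [[X1 FX1]|/forallNP F0] := pselect (exists X, F X); last first.
    suff -> : (\bigcup_(X in F) X `|` X0 = X0)%classic by [].
    by apply/seteqP; split=> x; [case=> [[X /F0]|] | move=> ?; right].
  pose F' := fun Y : set T => exists2 X, F X & Y = (X `|` X0)%classic.
  have := chain F'; set U := (X in P X).
  have <- : U = (\bigcup_(X in F) X `|` X0)%classic.
    apply/seteqP; split=> x.
      by case=> Y [[X FX ->]] [Xx|?]; [left; exists X | right].
    case=> [[X FX Xx]|X0x].
      by exists (X `|` X0)%classic; split; [exists X | left].
    by exists (X1 `|` X0)%classic; split; [exists X1 | right].
  apply.
  - by exists (X1 `|` X0)%classic; exists X1.
  - by move=> Y [X /FP ? ->].
  - move=> _ _ [X FX ->] [Y FY ->].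
    by have [XY|YX] := Ftot _ _ FX FY; [left|right]; apply: setSU.
exists (A `|` X0)%classic; split => // Y PY AY; apply: contrapT => nYA; apply: (Amax Y).
  split; first by move=> x Ax; apply: AY; left.
  by move=> YA; apply: nYA => x /YA ?; left.
suff -> : (Y `|` X0)%classic = Y by [].
by apply/seteqP; split=> x; [case=> // X0x; apply: AY; right | move=> Yx; left].
Qed.

End Zorn.

Section Ideals.
Variable A : comNzRingType.
Implicit Types (J : A -> Prop) (a x y : A).

Definition is_ideal J :=
  [/\ J 0, forall x y, J x -> J y -> J (x + y) & forall a x, J x -> J (a * x)].

Definition add_gen J a : A -> Prop := fun x => exists j u, J j /\ x = j + u * a.

Lemma idealN J : is_ideal J -> forall x, J x -> J (- x).
Proof. by case=> _ _ JM x Jx; rewrite -mulN1r; apply: JM. Qed.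

Lemma idealB J : is_ideal J -> forall x y, J x -> J y -> J (x - y).
Proof. by move=> id x y Jx Jy; case: (id) => _ JD _; apply: JD => //; apply: idealN. Qed.

Lemma ideal_sum J : is_ideal J -> forall (I : Type) (r : seq I) (P : pred I) (F : I -> A),
  (forall i, P i -> J (F i)) -> J (\sum_(i <- r | P i) F i).
Proof. by case=> J0 JD _ I r P F JF; apply: big_ind. Qed.

Lemma ideal_add_gen J a : is_ideal J -> is_ideal (add_gen J a).
Proof.
case=> J0 JD JM; split.
- by exists 0, 0; rewrite mul0r addr0.
- move=> _ _ [j [u [Jj ->]]] [k [v [Jk ->]]].
  by exists (j + k), (u + v); split; [exact: JD | ring].
- by move=> b _ [j [u [Jj ->]]]; exists (b * j), (b * u); split; [exact: JM | ring].
Qed.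

Lemma sub_add_gen J a x : J x -> add_gen J a x.
Proof. by move=> Jx; exists x, 0; rewrite mul0r addr0. Qed.

Lemma mem_add_gen J a : J 0 -> add_gen J a a.
Proof. by move=> J0; exists 0, 1; rewrite mul1r add0r. Qed.

(** Two notions of [good] are used later: missing a multiplicative set, and having large
    dimension. *)
Lemma maximal_ideal (good : (A -> Prop) -> Prop) I0 : is_ideal I0 -> good I0 ->
  (forall F : set (set A), (exists X, F X) ->
     (forall X, F X -> is_ideal X /\ good X) ->
     (forall X Y, F X -> F Y -> (X `<=` Y)%classic \/ (Y `<=` X)%classic) ->
     good (fun x => exists X, F X /\ X x)) ->
  exists J, [/\ is_ideal J, good J, forall x, I0 x -> J x &
    forall a, ~ J a -> ~ good (add_gen J a)].
Proof.
move=> id0 good0 chain.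
have [||J [[idJ gJ] I0J Jmax]] := @zorn_above A (fun X => is_ideal X /\ good X) I0.
- by split.
- move=> F [X1 FX1] FP tot; split; last by apply: chain => //; exists X1.
  split.
  + by exists X1; split => //; case: (FP _ FX1) => -[].
  + move=> x y [X [FX Xx]] [Y [FY Yy]].
    have [XY|YX] := tot _ _ FX FY.
      by exists Y; split => //; case: (FP _ FY) => -[_ YD _] _; apply: YD => //; exact: XY.
    by exists X; split => //; case: (FP _ FX) => -[_ XD _] _; apply: XD => //; exact: YX.
  + by move=> a x [X [FX Xx]]; exists X; split => //; case: (FP _ FX) => -[_ _ XM] _; exact: XM.
exists J; split => // a nJa gJa; apply: nJa.
apply: (Jmax (add_gen J a)); first by split => //; exact: ideal_add_gen.
  by move=> x; exact: sub_add_gen.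
by apply: mem_add_gen; case: idJ.
Qed.

(** If neither [x] nor [y] is in [Q], then [S] meets both [Q + (x)] and [Q + (y)], and the product
    of the two elements found lies in [Q + (xy)]. The last clause keeps the maximality: modulo [Q]
    every nonzero element divides an element of [S]. *)
Lemma prime_avoiding (S I0 : A -> Prop) : is_ideal I0 -> S 1 ->
  (forall x y, S x -> S y -> S (x * y)) -> (forall x, S x -> ~ I0 x) ->
  exists Q, [/\ is_ideal Q, (forall x, I0 x -> Q x), (forall x, S x -> ~ Q x),
    (forall x y, Q (x * y) -> Q x \/ Q y) &
    (forall a, ~ Q a -> exists s q u, [/\ S s, Q q & s = q + u * a])].
Proof.
move=> id0 S1 SM SI0.
have [||Q [idQ gQ I0Q Qmax]] :=
    @maximal_ideal (fun J => forall x, S x -> ~ J x) I0 id0.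
- exact: SI0.
- by move=> F _ FP _ x Sx [X [/FP[_ gX] /(gX _ Sx)]].
have Qgen a : ~ Q a -> exists s q u, [/\ S s, Q q & s = q + u * a].
  move=> /Qmax/existsNP[s /not_implyP[Ss /contrapT[q [u [Qq e]]]]].
  by exists s, q, u.
exists Q; split => // x y Qxy; apply: contrapT => /not_orP[/Qgen[s [q [u [Ss Qq es]]]]].
move=> /Qgen[s' [q' [u' [Ss' Qq' es']]]].
apply: (gQ _ (SM _ _ Ss Ss')); rewrite es es'.
have -> : (q + u * x) * (q' + u' * y) =
    (q' + u' * y) * q + ((u * x) * q' + (u * u') * (x * y)) by ring.
by case: idQ => _ QD QM; apply: (QD _ _ (QM _ _ Qq)); apply: (QD _ _ (QM _ _ Qq')); exact: QM.
Qed.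

End Ideals.

Section QuotientField.
Variables (A : comNzRingType) (Q : A -> Prop).
Hypotheses (idQ : is_ideal Q) (properQ : ~ Q 1)
  (invQ : forall a, ~ Q a -> exists b, Q (1 - b * a)).

Let Qb : {pred A} := fun x => `[< Q x >].

Let Qb_closed : idealr_closed Qb.
Proof.
split.
- by apply/asboolP; case: idQ.
- by apply/negP => /asboolP.
- move=> a x y /asboolP Qx /asboolP Qy; apply/asboolP.
  by case: idQ => _ QD QM; apply: QD => //; exact: QM.
Qed.

HB.instance Definition _ := isIdealr.Build A Qb Qb_closed.

Definition quo := {ideal_quot Qb}.
HB.instance Definition _ := GRing.ComNzRing.on quo.

Let piQ x : (\pi_quo x == 0 :> quo)%qT = Qb x.
Proof. by rewrite -(rmorph0 (\pi_quo)%qT) -Quotient.idealrBE subr0. Qed.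

Let quo_inv (x : quo) : quo := 
  if pselect (exists y, y * x = 1) is left h then projT1 (cid h) else 0.

Let quo_mulV (x : quo) : x != 0 -> quo_inv x * x = 1.
Proof.
rewrite /quo_inv; case: pselect => [h _|]; first by case: cid.
move=> nh /eqP x0; case: nh; move: x x0.
elim/quotW => a /eqP; rewrite piQ => /asboolP/invQ[b Qb1].
exists (\pi_quo b)%qT; rewrite -rmorphM -(rmorph1 (\pi_quo)%qT); apply/eqP.
rewrite -subr_eq0 -rmorphB piQ; apply/asboolP; rewrite -opprB; exact: idealN.
Qed.

Let quo_inv0 : quo_inv 0 = 0.
Proof.
rewrite /quo_inv; case: pselect => // h; exfalso; case: h => y.
by rewrite mulr0 => /eqP; rewrite eq_sym oner_eq0.
Qed.

HB.instance Definition _ := GRing.ComNzRing_isField.Build quo quo_mulV quo_inv0.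

Lemma quotient_field :
  exists (K : fieldType) (psi : {rmorphism A -> K}), forall a, psi a = 0 <-> Q a.
Proof.
exists (quo : fieldType), (\pi_quo)%qT => a.
by split=> [/eqP|Qa]; [rewrite piQ => /asboolP | apply/eqP; rewrite piQ; apply/asboolP].
Qed.

End QuotientField.

(** * Extension of places *)

Section PlaceExtension.
Variables (C : closedFieldType) (K : fieldType) (iota : {rmorphism C -> K}).

(** The graph of a ring morphism to [C], identical on [C], from a subring of [K]. A set of pairs is
    ready for Zorn's lemma, and single-valuedness reduces to the value at 0. *)
Definition partial_morphism (G : K * C -> Prop) :=
  [/\ forall c, G (iota c, c), forall x y, G x -> G y -> G (x + y),
      forall x y, G x -> G y -> G (x * y) & forall w, G (0, w) -> w = 0].

Section Relation.
Variable G : K * C -> Prop.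
Hypothesis pmG : partial_morphism G.

Let G0 : G (0, 0). Proof. by rewrite -(rmorph0 iota); case: pmG. Qed.
Let G1 : G (1, 1). Proof. by rewrite -(rmorph1 iota); case: pmG. Qed.
Let GD x y v w : G (x, v) -> G (y, w) -> G (x + y, v + w).
Proof. by case: pmG => _ GD _ _; apply: (GD (x, v) (y, w)). Qed.
Let GM x y v w : G (x, v) -> G (y, w) -> G (x * y, v * w).
Proof. by case: pmG => _ _ GM _; apply: (GM (x, v) (y, w)). Qed.
Let GN x v : G (x, v) -> G (- x, - v).
Proof. 
move=> h; rewrite -mulN1r -[- v]mulN1r; apply: GM => //.
by rewrite -(rmorph1 iota) -rmorphN; case: pmG.
Qed.
Let GX x v k : G (x, v) -> G (x ^+ k, v ^+ k).
Proof. by move=> h; elim: k => [|k IH]; [exact: G1 | rewrite !exprS; apply: GM]. Qed.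
Let Gsum (I : Type) (r : seq I) (F : I -> K) (H : I -> C) :
  (forall i, G (F i, H i)) -> G (\sum_(i <- r) F i, \sum_(i <- r) H i).
Proof.
by move=> FH; elim: r => [|i r IH]; rewrite ?big_nil ?big_cons //; apply: GD.
Qed.
Let Gfun w : G (0, w) -> w = 0. Proof. by case: pmG => _ _ _; apply. Qed.

Let Gp (p : {poly K}) (q : {poly C}) := forall i, G (p`_i, q`_i).

Let GpM p q r s : Gp p q -> Gp r s -> Gp (p * r) (q * s).
Proof. by move=> pq rs i; rewrite !coefM; apply: Gsum => k; apply: GM; [exact: pq | exact: rs]. Qed.

Let Gp_iota q : Gp (map_poly iota q) q.
Proof. by move=> i; rewrite coef_map; case: pmG => + _ _ _; apply. Qed.

Lemma partial_morphism_localize b w : G (b, w) -> w != 0 ->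
  exists G', [/\ partial_morphism G', forall x, G x -> G' x & G' (b^-1, w^-1)].
Proof.
move=> Gb w0; have b0 : b != 0.
  by apply: contraNneq w0 => b0; rewrite (Gfun (w := w)) // -b0.
exists (fun x => exists k a v, [/\ G (a, v), x.1 = a / b ^+ k & x.2 = v / w ^+ k]); split.
- split.
  + by move=> c; exists 0, (iota c), c; rewrite !expr0 !divr1; split => //; case: pmG.
  + move=> [x y] [x' y'] [k [a [v [Ga /= -> ->]]]] [k' [a' [v' [Ga' /= -> ->]]]].
    exists (k + k')%N, (a * b ^+ k' + a' * b ^+ k), (v * w ^+ k' + v' * w ^+ k).
    split; first by apply: GD; apply: GM => //; apply: GX.
      by rewrite /= exprD; field; rewrite !expf_neq0.
    by rewrite /= exprD; field; rewrite !expf_neq0.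
  + move=> [x y] [x' y'] [k [a [v [Ga /= -> ->]]]] [k' [a' [v' [Ga' /= -> ->]]]].
    exists (k + k')%N, (a * a'), (v * v'); split; first exact: GM.
      by rewrite /= exprD; field; rewrite !expf_neq0.
    by rewrite /= exprD; field; rewrite !expf_neq0.
  + move=> _ [k [a [v [Ga /= /esym/eqP + ->]]]].
    rewrite mulf_eq0 invr_eq0 (negPf (expf_neq0 _ b0)) orbF => /eqP a0.
    by rewrite (Gfun (w := v)) ?mul0r // -a0.
- by move=> [x y] Gx; exists 0, x, y; rewrite !expr0 !divr1.
- by exists 1%N, 1, 1; rewrite !expr1 !mul1r.
Qed.

(* The coefficientwise images of the polynomials killed by [x] form an ideal of
   [C[X]]; it is principal, and a root of its generator is a legal value for [x]. *)
Lemma partial_morphism_adjoin x : (forall p, Gp p 1 -> p.[x] != 0) ->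
  exists G', [/\ partial_morphism G', forall y, G y -> G' y & exists c, G' (x, c)].
Proof.
move=> proper.
have [c cP] : exists c, forall p q, Gp p q -> p.[x] = 0 -> q.[c] = 0.
  pose J := fun q => exists p, Gp p q /\ p.[x] = 0.
  have [[q [q0 Jq]]|noq] := pselect (exists q, q != 0 /\ J q); last first.
    exists 0 => p q Gpq px; have [->|q0] := eqVneq q 0; first exact: horner0.
    by case: noq; exists q; split => //; exists p.
  have exq : exists k, `[< exists q, [/\ q != 0, J q & size q = k] >].
    by exists (size q); apply/asboolP; exists q.
  case: (ex_minnP exq) => k /asboolP[{}q [{}q0 {}Jq sq]] kmin.
  case: (Jq) => p [Gpq px].
  have /closed_rootP[c /eqP qc] : size q != 1%N.
    apply/negP => /size_poly1P[a a0 qa].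
    (* A constant generator would give, after scaling, a polynomial with image 1 that vanishes at
       [x]. *)
    have := proper (p * (iota a^-1)%:P); rewrite hornerM px mul0r eqxx.
    suff: Gp (p * (iota a^-1)%:P) 1 by move=> h /(_ h).
    have -> : 1 = q * (a^-1)%:P by rewrite qa -polyCM mulfV.
    by rewrite -map_polyC; exact: GpM.
  exists c => r s Grs rx; rewrite (divp_eq s q) hornerD hornerM qc mulr0 add0r.
  have [->|m0] := eqVneq (s %% q) 0; first exact: horner0.
  have /negP[] : ~~ (k <= size (s %% q)%R)%N by rewrite -sq -ltnNge ltn_modp.
  apply: kmin; apply/asboolP; exists (s %% q); split => //.
  exists (r - map_poly iota (s %/ q) * p); split; last first.
    by rewrite !hornerE rx px mulr0 subrr.
  have -> : s %% q = s - s %/ q * q by rewrite {2}(divp_eq s q) addrAC subrr add0r.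
  move=> i; rewrite !coefB; apply: GD => //; apply: GN.
  by apply: GpM.
exists (fun y => exists p q, [/\ Gp p q, y.1 = p.[x] & y.2 = q.[c]]); split.
- split.
  + move=> a; exists (iota a)%:P, a%:P; rewrite !hornerC; split => //.
    by rewrite -map_polyC; exact: Gp_iota.
  + move=> [y v] [y' v'] [p [q [Gpq /= -> ->]]] [p' [q' [Gpq' /= -> ->]]].
    exists (p + p'), (q + q'); rewrite !hornerD; split => //.
    by move=> i; rewrite !coefD; apply: GD.
  + move=> [y v] [y' v'] [p [q [Gpq /= -> ->]]] [p' [q' [Gpq' /= -> ->]]].
    by exists (p * p'), (q * q'); rewrite !hornerM; split => //; exact: GpM.
  + by move=> w [p [q [/= Gpq /esym px ->]]]; exact: cP Gpq px.
- move=> [y v] Gy; exists y%:P, v%:P; rewrite !hornerC; split => // i.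
  by rewrite !coefC; case: ifP.
- by exists c, 'X, 'X; rewrite !hornerX; split => // i; rewrite !coefX; case: (_ == _).
Qed.

(** Both relations have a constant coefficient of value 1 and all others of value 0. The shorter
    one, reversed, cancels the leading term of the longer one without changing these values, so the
    total size drops. Exchanging [x] and [x^-1] lets [q] be the shorter. *)
Lemma improper_inverse (x : K) : x != 0 ->
  (forall b w, G (b, w) -> w != 0 -> G (b^-1, w^-1)) ->
  forall p q, Gp p 1 -> p.[x] = 0 -> Gp q 1 -> q.[x^-1] = 0 -> False.
Proof.
move=> + Ginv.
suff main N : forall (x : K) (p : {poly K}) (q : {poly K}), (size p + size q <= N)%N -> (size q <= size p)%N ->
    x != 0 -> Gp p 1 -> p.[x] = 0 -> Gp q 1 -> q.[x^-1] = 0 -> False.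
  move=> x0 p q Gp1 px Gq1 qx; case: (leqP (size q) (size p)) => [le|/ltnW le].
    exact: (main _ x p q (leqnn _)).
  by apply: (main _ x^-1 q p (leqnn _)); rewrite ?invr_eq0 ?invrK.
elim: N => [|N IH] {}x p q.
  rewrite leqn0 addn_eq0 size_poly_eq0 => /andP[/eqP-> _] _ _ /(_ 0%N).
  rewrite coef0 coef1 => /Gfun /eqP; by rewrite oner_eq0.
move=> szN szqp x0 Gp1 px Gq1 qx.
have Gp0 : G (p`_0, 1) by have := Gp1 0%N; rewrite coef1.
have Gq0 : G (q`_0, 1) by have := Gq1 0%N; rewrite coef1.
have q00 : q`_0 != 0.
  by apply/eqP => q0; move: Gq0; rewrite q0 => /Gfun/eqP; rewrite oner_eq0.
have Gqi : G ((q`_0)^-1, 1) by rewrite -invr1; apply: Ginv => //; exact: oner_neq0.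
case sp : (size p) => [|[|k]].
- move/eqP: sp; rewrite size_poly_eq0 => /eqP p0.
  by move: Gp0; rewrite p0 coef0 => /Gfun/eqP; rewrite oner_eq0.
- move/eqP/size_poly1P: sp => [c c0 pc]; move: px; rewrite pc hornerC => /eqP.
  by rewrite (negPf c0).
(* [r] is $X^{k+1}q(1/X)$; its leading coefficient is the constant coefficient of [q], whose inverse
   also has value 1. *)
pose r := \poly_(j < k.+2) q`_(k.+1 - j).
have rx : r.[x] = 0.
  rewrite horner_poly (reindex_inj rev_ord_inj) /=.
  suff -> : \sum_(j < k.+2) q`_(k.+1 - (k.+2 - j.+1)) * x ^+ (k.+2 - j.+1) =
            x ^+ k.+1 * q.[x^-1] by rewrite qx mulr0.
  rewrite (@horner_coef_wide _ k.+2) -?sp // mulr_sumr sp; apply: eq_bigr => j _.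
  have jk : (j <= k.+1)%N by rewrite -ltnS.
  rewrite subSS subKn // mulrCA; congr (_ * _).
  by rewrite expfB_cond ?(negPf x0) // exprVn.
pose p' := p - (p`_k.+1 / q`_0) *: r.
have Gpk : G (p`_k.+1 / q`_0, 0).
  have Gk : G (p`_k.+1, 0) by have := Gp1 k.+1; rewrite coef1.
  by have := GM Gk Gqi; rewrite mul0r.
have Gp' : Gp p' 1.
  move=> j; rewrite coefB coefZ coef_poly -[X in G (_, X)]subr0.
  apply: GD => //; apply: GN; case: ifP => _; last by rewrite mulr0.
  by have := GM Gpk (Gq1 (k.+1 - j)%N); rewrite mul0r.
have p'x : p'.[x] = 0 by rewrite !hornerE px rx; ring.
have sp' : (size p' <= k.+1)%N.
  apply/leq_sizeP => j; rewrite leq_eqVlt => /orP[/eqP<-|kj].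
    by rewrite coefB coefZ coef_poly ltnSn subnn; field.
  rewrite coefB coefZ coef_poly ltnS leqNgt kj /= mulr0 subr0.
  by apply/eqP; move: (leq_sizeP _ _ (eq_leq sp)) => -> //.
have [le|/ltnW le] := leqP (size q) (size p').
  apply: (IH x p' q) => //; move: szN; rewrite sp; lia.
apply: (IH x^-1 q p'); rewrite ?invr_eq0 ?invrK //; move: szN; rewrite sp; lia.
Qed.

End Relation.

(** A maximal graph is closed under inverting elements of nonzero value, by localization. By
    [improper_inverse] one of [x] and [x^-1] can be adjoined, hence already has a value; if [x^-1]
    has a nonzero value, so has [x]. *)
Lemma place_extension G0 : partial_morphism G0 ->
  exists G, [/\ partial_morphism G, forall x, G0 x -> G x,
    forall x w, G (x, w) -> w != 0 -> G (x^-1, w^-1) &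
    forall x, (exists w, G (x, w)) \/ G (x^-1, 0)].
Proof.
move=> pm0.
have [|G [pmG G0G Gmax]] := zorn_above (P := partial_morphism) pm0.
  move=> F [X1 FX1] FP tot; split.
  - by move=> c; exists X1; split => //; case: (FP _ FX1).
  - move=> x y [X [FX Xx]] [Y [FY Yy]]; case: (tot _ _ FX FY) => [XY|YX].
      by exists Y; split => //; case: (FP _ FY) => _ YD _ _; apply: YD => //; exact: XY.
    by exists X; split => //; case: (FP _ FX) => _ XD _ _; apply: XD => //; exact: YX.
  - move=> x y [X [FX Xx]] [Y [FY Yy]]; case: (tot _ _ FX FY) => [XY|YX].
      by exists Y; split => //; case: (FP _ FY) => _ _ YM _; apply: YM => //; exact: XY.
    by exists X; split => //; case: (FP _ FX) => _ _ XM _; apply: XM => //; exact: YX.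
  - by move=> w [X [/FP[_ _ _ X0] /X0]].
have Ginv x w : G (x, w) -> w != 0 -> G (x^-1, w^-1).
  move=> Gx w0; have [G' [pmG' GG' Gb]] := partial_morphism_localize pmG Gx w0.
  exact: (Gmax G').
have adj x : (forall p : {poly K}, (forall i, G (p`_i, (1 : {poly C})`_i)) -> p.[x] != 0) ->
    exists w, G (x, w).
  move=> /(partial_morphism_adjoin pmG)[G' [pmG' GG' [c Gc]]].
  by exists c; exact: (Gmax G').
exists G; split => // x.
have [->|x0] := eqVneq x 0.
  by left; exists 0; rewrite -(rmorph0 iota); case: pmG.
have [h|/existsNP[p /not_implyP[Gp /negP/negPn/eqP px]]] := 
  pselect (forall p : {poly K}, (forall i, G (p`_i, (1 : {poly C})`_i)) -> p.[x] != 0).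
  by left; exact: adj.
have [h|/existsNP[q /not_implyP[Gq /negP/negPn/eqP qx]]] := 
  pselect (forall p : {poly K}, (forall i, G (p`_i, (1 : {poly C})`_i)) -> p.[x^-1] != 0).
  have [w Gw] := adj _ h; have [w0|w0] := eqVneq w 0; first by right; rewrite -w0.
  by left; exists w^-1; rewrite -(invrK x); exact: Ginv.
by case: (improper_inverse pmG x0 Ginv Gp px Gq qx).
Qed.

End PlaceExtension.

(** * The subring and the residue map given by a partial morphism *)

Section ValuationRing.
Variables (C : closedFieldType) (K : fieldType) (iota : {rmorphism C -> K}).
Variable G : K * C -> Prop.
Hypothesis pmG : partial_morphism iota G.

Definition vring_pred : {pred K} := fun x => `[< exists w, G (x, w) >].

Let GN x v : G (x, v) -> G (- x, - v).
Proof. 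
case: pmG => Gi _ GM _ h; have := GM _ _ (Gi (-1)) h.
by rewrite rmorphN rmorph1; congr G; congr pair => /=; rewrite mulN1r.
Qed.

Lemma vring_subring : subring_closed vring_pred.
Proof.
case: (pmG) => Gi GD GM _; split.
- by apply/asboolP; exists 1; rewrite -(rmorph1 iota).
- move=> x y /asboolP[v Gv] /asboolP[w Gw]; apply/asboolP; exists (v - w).
  by apply: (GD (x, v) (- y, - w)) => //; exact: GN.
- move=> x y /asboolP[v Gv] /asboolP[w Gw]; apply/asboolP; exists (v * w).
  by apply: (GM (x, v) (y, w)).
Qed.

HB.instance Definition _ := GRing.isSubringClosed.Build K vring_pred vring_subring.

Definition vring := {x | x \in vring_pred}.
HB.instance Definition _ := SubChoice.on vring.
HB.instance Definition _ := [SubChoice_isSubComNzRing of vring by <:].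

Definition vring_res (y : vring) : C := projT1 (cid (asboolP _ (valP y))).

Let resP y : G (val y, vring_res y).
Proof. by rewrite /vring_res; case: cid. Qed.

Let res_uniq y w : G (val y, w) -> vring_res y = w.
Proof.
case: (pmG) => _ GD _ Gf Gw; apply/eqP; rewrite -subr_eq0; apply/eqP; apply: Gf.
rewrite -(subrr (val y)); apply: (GD (val y, _) (- val y, - w)) => //; exact: GN.
Qed.

Let res_zmod : zmod_morphism vring_res.
Proof.
case: (pmG) => _ GD _ _ x y; apply: res_uniq; rewrite rmorphB.
by apply: (GD (val x, _) (- val y, - vring_res y)) => //; exact: GN.
Qed.

Let res_mon : monoid_morphism vring_res.
Proof.
case: (pmG) => Gi _ GM _; split.
  by apply: res_uniq; rewrite rmorph1 -{1}(rmorph1 iota).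
move=> x y; apply: res_uniq; rewrite rmorphM.
by apply: (GM (val x, _) (val y, _)).
Qed.

HB.instance Definition _ := GRing.isZmodMorphism.Build vring C vring_res res_zmod.
HB.instance Definition _ := GRing.isMonoidMorphism.Build vring C vring_res res_mon.

Lemma valuation_ring : exists (O : comNzRingType) (j : {rmorphism O -> K}) (phi : {rmorphism O -> C}),
  injective j /\ forall x w, G (x, w) <-> exists y, j y = x /\ phi y = w.
Proof.
exists (vring : comNzRingType), (val : {rmorphism vring -> K}), (vring_res : {rmorphism vring -> C}).
split=> [|x w]; first exact: val_inj.
split=> [Gx|[y [<- <-]]]; last exact: resP.
have xP : x \in vring_pred by apply/asboolP; exists w.
by exists (exist _ x xP : vring); split => //; exact: res_uniq.
Qed.

End ValuationRing.

(** A valuation ring of [K] seen through its embedding [j] and its residue map [phi], whose kernel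
    is the maximal ideal. *)
Record is_place (C K : fieldType) (O : comNzRingType)
    (j : {rmorphism O -> K}) (phi : {rmorphism O -> C}) : Prop := IsPlace {
  place_inj : injective j;
  place_unit : forall y, phi y != 0 -> exists z, y * z = 1;
  place_total : forall x, (exists y, j y = x) \/ (exists y, j y = x^-1 /\ phi y = 0)
}.

Lemma exists_place (C : closedFieldType) (K : fieldType) (iota : {rmorphism C -> K}) G0 :
  partial_morphism iota G0 ->
  exists (O : comNzRingType) (j : {rmorphism O -> K}) (phi : {rmorphism O -> C}),
    is_place j phi /\ forall x w, G0 (x, w) -> exists y, j y = x /\ phi y = w.
Proof.
move=> /place_extension[G [pmG G0G Ginv Gtot]].
have [O [j [phi [jinj GP]]]] := valuation_ring pmG.
exists O, j, phi; split; last by move=> x w /G0G/GP.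
split => //.
- move=> y y0; have : G (j y, phi y) by apply/GP; exists y.
  move=> Gy; case/GP: (Ginv _ _ Gy y0) => z [jz phiz]; exists z; apply: (jinj).
  rewrite rmorphM rmorph1 jz mulfV //; apply: contraNneq y0.
  by rewrite -(rmorph0 j) => /jinj ->; rewrite rmorph0.
- move=> x; case: (Gtot x) => [[w /GP[y [<- _]]]|/GP[y [yx y0]]].
    by left; exists y.
  by right; exists y.
Qed.

(** * Cartan decomposition over a valuation ring *)

Section Smith.
Variables (C K : fieldType) (O : comNzRingType).
Variables (j : {rmorphism O -> K}) (phi : {rmorphism O -> C}).
Hypothesis plc : is_place j phi.

Definition integral_elt (x : K) := exists y, j y = x.

Lemma integral0 : integral_elt 0. Proof. by exists 0; rewrite rmorph0. Qed.
Lemma integral1 : integral_elt 1. Proof. by exists 1; rewrite rmorph1. Qed.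
Lemma integralD x y : integral_elt x -> integral_elt y -> integral_elt (x + y).
Proof. by case=> u <- [v <-]; exists (u + v); rewrite rmorphD. Qed.
Lemma integralN x : integral_elt x -> integral_elt (- x).
Proof. by case=> u <-; exists (- u); rewrite rmorphN. Qed.
Lemma integralM x y : integral_elt x -> integral_elt y -> integral_elt (x * y).
Proof. by case=> u <- [v <-]; exists (u * v); rewrite rmorphM. Qed.
Lemma integral_sum (I : Type) (r : seq I) (F : I -> K) :
  (forall i, integral_elt (F i)) -> integral_elt (\sum_(i <- r) F i).
Proof. by move=> FO; apply: big_ind => // [|x y]; [exact: integral0 | exact: integralD]. Qed.

Lemma integralV x : integral_elt x \/ integral_elt x^-1.
Proof. by case: (place_total plc x) => [|[y [yx _]]]; [left | right; exists y]. Qed.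

Lemma integral_mx m n (M : 'M[K]_(m, n)) :
  (forall i k, integral_elt (M i k)) -> exists B : 'M[O]_(m, n), map_mx j B = M.
Proof.
move=> MO; have /choice[f fP] : forall p : 'I_m * 'I_n, exists y, j y = M p.1 p.2.
  by move=> [i k]; exact: MO.
by exists (\matrix_(i, k) f (i, k)); apply/matrixP => i k; rewrite !mxE fP.
Qed.

Lemma exists_divisor (s : seq K) : (exists2 x, x \in s & x != 0) ->
  exists x, [/\ x \in s, x != 0 & forall y, y \in s -> integral_elt (y / x)].
Proof.
elim: s => [[x]//|z s IH] [x xs x0].
have [[y ys y0]|nos] := pselect (exists2 y, y \in s & y != 0); last first.
  exists x; split => // y; rewrite inE => /orP[/eqP->|ys]; last first.
    have [->|y0] := eqVneq y 0; first by rewrite mul0r; exact: integral0.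
    by case: nos; exists y.
  move: xs; rewrite inE => /orP[/eqP<-|xs]; first by rewrite mulfV //; exact: integral1.
  by case: nos; exists x.
have [|w [ws w0 wd]] := IH; first by exists y.
case: (integralV (z / w)) => [h|h].
  by exists w; split; rewrite ?inE ?ws ?orbT // => v; rewrite inE => /orP[/eqP->//|/wd].
have [z0|z0] := eqVneq z 0.
  exists w; split; rewrite ?inE ?ws ?orbT // => v; rewrite inE => /orP[/eqP->|/wd//].
  by rewrite z0 mul0r; exact: integral0.
exists z; split; rewrite ?inE ?eqxx // => v; rewrite inE => /orP[/eqP->|/wd vw].
  by rewrite mulfV //; exact: integral1.
have -> : v / z = (v / w) * (z / w)^-1 by field; rewrite w0 z0.
exact: integralM.
Qed.

Definition inverse_mx n (A B : 'M[O]_n) := A *m B = 1%:M /\ B *m A = 1%:M.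

Lemma inverse_mxM n (A A' B B' : 'M[O]_n) :
  inverse_mx A A' -> inverse_mx B B' -> inverse_mx (A *m B) (B' *m A').
Proof.
case=> AA A'A [BB B'B]; split; rewrite -mulmxA.
  by rewrite (mulmxA B) BB mul1mx AA.
by rewrite (mulmxA A') A'A mul1mx B'B.
Qed.

Lemma inverse_tperm n (i k : 'I_n) :
  inverse_mx (tperm_mx i k) (tperm_mx i k).
Proof. by split; rewrite /tperm_mx -perm_mxM tperm2 perm_mx1. Qed.

(** Gaussian elimination with a pivot dividing every entry, which exists because divisibility is
    total: the multipliers are integral, and the Schur complement is again divisible by the pivot,
    so the diagonal is ordered by divisibility. *)
Theorem smith_normal_form n (M : 'M[K]_n) : \det M != 0 ->
  exists (L L' U U' : 'M[O]_n) (a : 'rV[K]_n),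
  [/\ inverse_mx L L', inverse_mx U U', map_mx j L *m M *m map_mx j U = diag_mx a,
    forall i, a 0 i != 0 &
    forall i k : 'I_n, (i <= k)%N -> integral_elt (a 0 k / a 0 i)].
Proof.
elim: n M => [|n IH] M detM.
  exists 1%:M, 1%:M, 1%:M, 1%:M, 0; split.
  - by split; rewrite mulmx1.
  - by split; rewrite mulmx1.
  - by apply/matrixP => -[].
  - by case.
  - by case.
have [|x [/allpairsP[[i0 k0] /= [_ _ xM]] x0 xdiv]] :=
    exists_divisor (s := [seq M i k | i <- enum 'I_n.+1, k <- enum 'I_n.+1]).
  apply: contrapT => /forall2NP h; case/eqP: detM.
  suff -> : M = 0 by rewrite det0.
  apply/matrixP => i k; rewrite mxE; have [|/negP/negPn/eqP//] := h (M i k).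
  by case; apply/allpairsP; exists (i, k); rewrite !mem_enum.
have {}xdiv i k : integral_elt (M i k / x).
  by apply: xdiv; apply/allpairsP; exists (i, k); rewrite !mem_enum.
have [M1 M1def] : exists M1 : 'M_(1 + n), M1 = tperm_mx 0 i0 *m M *m tperm_mx 0 k0 by eexists.
have M1E i k : M1 i k = M (tperm 0 i0 i) (tperm 0 k0 k).
  by rewrite M1def -xcolE -xrowE !mxE.
have M1div i k : integral_elt (M1 i k / x) by rewrite M1E.
have M100 : M1 0 0 = x by rewrite M1E !tpermL.
have e1 : ulsubmx M1 = x%:M.
  by apply/matrixP => i k; rewrite !ord1 !mxE eqxx mulr1n -[RHS]M100; congr (M1 _ _); apply/val_inj.
have [B Bj] : exists B, map_mx j B = - (x^-1 *: dlsubmx M1).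
  apply: integral_mx => i k; rewrite !mxE; apply: integralN.
  by rewrite mulrC.
have [D Dj] : exists D, map_mx j D = - (x^-1 *: ursubmx M1).
  apply: integral_mx => i k; rewrite !mxE; apply: integralN.
  by rewrite mulrC.
have [M2 M2def] : exists M2, M2 = drsubmx M1 - x^-1 *: (dlsubmx M1 *m ursubmx M1) by eexists.
pose L1 : 'M[O]_(1 + n) := block_mx 1%:M 0 B 1%:M.
pose U1 : 'M[O]_(1 + n) := block_mx 1%:M D 0 1%:M.
have L1inv : inverse_mx L1 (block_mx 1%:M 0 (- B) 1%:M).
  by split; rewrite mulmx_block !mulmx1 !mul1mx !mul0mx !mulmx0 !addr0 !add0r
    ?subrr ?addNr -?scalar_mx_block.
have U1inv : inverse_mx U1 (block_mx 1%:M (- D) 0 1%:M).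
  by split; rewrite mulmx_block !mulmx1 !mul1mx !mul0mx !mulmx0 !addr0 !add0r
    ?subrr ?addNr -?scalar_mx_block.
have red : map_mx j L1 *m M1 *m map_mx j U1 = block_mx x%:M 0 0 M2.
  have h1 : map_mx j B *m x%:M + dlsubmx M1 = 0.
    by rewrite Bj mul_mx_scalar scalerN scalerA mulfV // scale1r addNr.
  have h2 : x%:M *m map_mx j D + ursubmx M1 = 0.
    by rewrite Dj mul_scalar_mx scalerN scalerA mulfV // scale1r addNr.
  have h3 : map_mx j B *m ursubmx M1 + drsubmx M1 = M2.
    by rewrite Bj mulNmx -scalemxAl addrC M2def.
  rewrite -{1}[M1]submxK !map_block_mx !map_mx1 !map_mx0 !mulmx_block e1.
  by rewrite !mulmx1 !mul1mx !mul0mx !mulmx0 !addr0 h1 h2 h3 mul0mx add0r.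
have detM2 : \det M2 != 0.
  have : \det (map_mx j L1 *m M1 *m map_mx j U1) != 0.
    rewrite !det_mulmx !map_block_mx !map_mx1 !map_mx0 det_lblock det_ublock !det1.
    rewrite !mul1r !mulr1 M1def !det_mulmx !det_perm.
    by rewrite !mulf_neq0 ?expf_neq0 ?oppr_eq0 ?oner_neq0.
  by rewrite red det_ublock mulf_eq0 negb_or => /andP[].
have M2div i k : integral_elt (M2 i k / x).
  have -> : M2 i k / x = drsubmx M1 i k / x -
      (\sum_l (dlsubmx M1 i l / x) * (ursubmx M1 l k / x)).
    rewrite M2def !mxE mulrBl; congr (_ - _).
    rewrite mulr_sumr mulr_suml.
    by apply: eq_bigr => l _; field.
  apply: integralD; first by rewrite !mxE.
  by apply: integralN; apply: integral_sum => l; apply: integralM; rewrite !mxE.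
have [L2 [L2' [U2 [U2' [a [invL invU eqa a0 adiv]]]]]] := IH _ detM2.
pose lft (Z : 'M[O]_n) : 'M[O]_(1 + n) := block_mx 1%:M 0 0 Z.
have inv_lft Z Z' : inverse_mx Z Z' -> inverse_mx (lft Z) (lft Z').
  by case=> h h'; split; rewrite mulmx_block !mulmx1 !mul1mx !mul0mx !mulmx0 !addr0 ?add0r
     ?h ?h' -?scalar_mx_block.
exists (lft L2 *m (L1 *m tperm_mx 0 i0)), ((tperm_mx 0 i0 *m block_mx 1%:M 0 (- B) 1%:M) *m lft L2').
exists (tperm_mx 0 k0 *m U1 *m lft U2), (lft U2' *m (block_mx 1%:M (- D) 0 1%:M *m tperm_mx 0 k0)).
pose a' : 'rV[K]_(1 + n) := row_mx x%:M a.
have a'l : a' 0 0 = x.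
  have -> : 0 = lshift n (0 : 'I_1) by apply/val_inj.
  by rewrite row_mxEl mxE.
have a'r k : a' 0 (rshift 1 k) = a 0 k by rewrite row_mxEr.
have ord_cases (i : 'I_(1 + n)) : i = 0 \/ exists k, i = rshift 1 k.
  case: (splitP i) => k ik; first by left; apply/val_inj; rewrite /= ik ord1.
  by right; exists k; apply/val_inj.
exists a'; split.
- by apply: inverse_mxM; [exact: inv_lft | apply: inverse_mxM => //; exact: inverse_tperm].
- apply: inverse_mxM; last exact: inv_lft.
  by apply: inverse_mxM => //; exact: inverse_tperm.
- set lhs := (X in X = _).
  have {lhs} -> : lhs = map_mx j (lft L2) *m (map_mx j L1 *m M1 *m map_mx j U1) *m map_mx j (lft U2).
    by rewrite /lhs M1def !map_mxM !map_tperm_mx !mulmxA.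
  rewrite red.
  rewrite !map_block_mx !map_mx1 !map_mx0 !mulmx_block.
  rewrite !(mulmx1, mul1mx, mul0mx, mulmx0, addr0, add0r).
  rewrite eqa; apply: etrans (esym (diag_mx_row x%:M a)); congr block_mx.
  by apply/matrixP => i k; rewrite !ord1 !mxE eqxx mulr1n.
- by move=> i; case: (ord_cases i) => [->|[k ->]]; rewrite ?a'l ?a'r.
- move=> i k; case: (ord_cases i) => [->|[i' ->]]; case: (ord_cases k) => [->|[k' ->]] // ik.
  + by rewrite mulfV ?a'l //; exact: integral1.
  (* A later diagonal entry is an integral combination of entries of the Schur complement, hence a
     multiple of the pivot. *)
  + rewrite a'l a'r; have <- : (diag_mx a) k' k' = a 0 k' by rewrite mxE eqxx mulr1n.
    rewrite -eqa; have -> : (map_mx j L2 *m M2 *m map_mx j U2) k' k' / x =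
      \sum_l (\sum_m j (L2 k' m) * (M2 m l / x)) * j (U2 l k').
      rewrite mxE mulr_suml; apply: eq_bigr => l _; rewrite mulrAC !mxE.
      by congr (_ * _); rewrite mulr_suml; apply: eq_bigr => m _; rewrite !mxE mulrA.
    apply: integral_sum => l; apply: integralM; last by exists (U2 l k').
    by apply: integral_sum => m; apply: integralM => //; exists (L2 k' m).
  + by rewrite !a'r; apply: adiv; move: ik; rewrite /= leq_add2l.
Qed.

End Smith.

(** * Linear substitutions *)

Section LinearSubstitution.

Lemma mpoly_rmorph_ext n (A B : comNzRingType) (F H : {rmorphism {mpoly A[n]} -> B}) :
  (forall c, F c%:MP = H c%:MP) -> (forall i, F 'X_i = H 'X_i) -> F =1 H.
Proof.
move=> FC FX p; rewrite [p]mpolyE !rmorph_sum; apply: eq_bigr => m _.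
rewrite -mul_mpolyC !rmorphM FC; congr (_ * _).
rewrite mpolyXE_id !rmorph_prod; apply: eq_bigr => i _.
by rewrite !rmorphXn /= FX.
Qed.

Lemma mpoly_ring_ind n (A : comNzRingType) (P : {mpoly A[n]} -> Prop) :
  (forall c, P c%:MP) -> (forall i, P 'X_i) ->
  (forall p q, P p -> P q -> P (p + q)) -> (forall p q, P p -> P q -> P (p * q)) ->
  forall p, P p.
Proof.
move=> PC PX PD PM p; rewrite [p]mpolyE; apply: big_ind => [|//|m _].
  by rewrite -(mpolyC0 n A).
rewrite -mul_mpolyC; apply: (PM) => //; rewrite mpolyXE_id.
apply: big_ind => [|//|i _]; first by rewrite -(mpolyC1 n A).
by elim: (m i) => [|k IH]; [rewrite expr0 -(mpolyC1 n A) | rewrite exprS; apply: PM].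
Qed.

(** This is [act] over any commutative ring: it is needed over C, over the valuation ring, over [K]
    and over a ring of functions. *)
Definition lin_subst (A : comNzRingType) n (g : 'M[A]_n) (p : {mpoly A[n]}) : {mpoly A[n]} :=
  p \mPo [tuple \sum_(k < n) g i k *: 'X_k | i < n].

Variables (A : comNzRingType) (n : nat).
Implicit Types (g h : 'M[A]_n) (p q : {mpoly A[n]}).

Lemma lin_subst_is_zmod g : zmod_morphism (lin_subst g).
Proof. by move=> p q; rewrite /lin_subst rmorphB. Qed.
Lemma lin_subst_is_monoid g : monoid_morphism (lin_subst g).
Proof. by split=> [|p q]; rewrite /lin_subst ?rmorph1 ?rmorphM. Qed.
HB.instance Definition _ g := GRing.isZmodMorphism.Build _ _ (lin_subst g) (lin_subst_is_zmod g).
HB.instance Definition _ g := GRing.isMonoidMorphism.Build _ _ (lin_subst g) (lin_subst_is_monoid g).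

Lemma lin_substC g c : lin_subst g c%:MP = c%:MP.
Proof. exact: comp_mpolyC. Qed.

Lemma lin_substX g i : lin_subst g 'X_i = \sum_(k < n) g i k *: 'X_k.
Proof. by rewrite /lin_subst comp_mpolyXU -tnth_nth tnth_mktuple. Qed.

Lemma lin_substZ g c p : lin_subst g (c *: p) = c *: lin_subst g p.
Proof. exact: comp_mpolyZ. Qed.

Lemma lin_subst_mul g h p : lin_subst h (lin_subst g p) = lin_subst (g *m h) p.
Proof.
apply: (@mpoly_rmorph_ext _ _ _ (lin_subst h \o lin_subst g) (lin_subst (g *m h))) => [c|i] /=.
  by rewrite !lin_substC.
rewrite !lin_substX rmorph_sum /=.
under eq_bigr do rewrite lin_substZ lin_substX scaler_sumr.
rewrite exchange_big; apply: eq_bigr => k _; rewrite mxE scaler_suml.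
by apply: eq_bigr => l _; rewrite scalerA.
Qed.

Lemma lin_subst1 p : lin_subst 1%:M p = p.
Proof.
apply: (@mpoly_rmorph_ext _ _ _ (lin_subst 1%:M) idfun) => [c|i] /=; first exact: lin_substC.
rewrite lin_substX (bigD1 i) //= mxE eqxx scale1r big1 ?addr0 // => k ki.
by rewrite mxE eq_sym (negPf ki) scale0r.
Qed.

Lemma meval_lin_subst g p v :
  (lin_subst g p).@[v] = p.@[fun i => \sum_(k < n) g i k * v k].
Proof.
rewrite /lin_subst comp_mpoly_meval; congr (p.@[_]); apply/funext => i; rewrite tnth_mktuple.
by rewrite rmorph_sum; apply: eq_bigr => k _; rewrite /= mevalZ mevalXU.
Qed.

Lemma dhomog_lin_subst g p d : p \is d.-homog -> lin_subst g p \is d.-homog.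
Proof.
move=> hp; rewrite /lin_subst comp_mpolyE big_seq rpred_sum // => m mp; apply: rpredZ.
rewrite -(dhomog_mf hp mp) /= mdegE.
apply: (big_ind2 (fun (x : {mpoly A[n]}) e => x \is e.-homog)) => [|x e y f|i _].
- exact: dhomog1.
- exact: dhomogM.
- rewrite -[X in _ \is X.-homog]mul1n; apply: dhomogMn; rewrite tnth_mktuple rpred_sum // => k _.
  by apply: rpredZ; rewrite dhomogX /= mdeg1.
Qed.

Lemma coef_lin_subst_diag (a : 'rV[A]_n) p m :
  (lin_subst (diag_mx a) p)@_m = (\prod_(i < n) a 0 i ^+ m i) * p@_m.
Proof.
have monE m' : lin_subst (diag_mx a) 'X_[m'] = (\prod_(i < n) a 0 i ^+ m' i) *: 'X_[m'].
  rewrite mpolyXE_id rmorph_prod /= -scaler_prod; apply: eq_bigr => i _.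
  rewrite rmorphXn /= lin_substX (bigD1 i) //= mxE eqxx mulr1n big1 ?addr0 ?exprZn // => k ki.
  by rewrite mxE eq_sym (negPf ki) mulr0n scale0r.
rewrite {1}[p]mpolyE rmorph_sum /= raddf_sum /=.
under eq_bigr do rewrite lin_substZ monE scalerA mcoeffZ mcoeffX.
have [mp|mp] := boolP (m \in msupp p).
  rewrite (bigD1_seq m) ?msupp_uniq //= eqxx mulr1 mulrC [X in _ + X]big1 ?addr0 // => m' m'm.
  by rewrite (negPf m'm) mulr0.
rewrite (memN_msupp_eq0 mp) mulr0 big_seq [LHS]big1 // => m' m'p.
by case: eqP m'p mp => [->->|]; rewrite ?mulr0.
Qed.

Lemma mderivXU (i k : 'I_n) : ('X_i : {mpoly A[n]})^`M(k) = (i == k)%:R.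
Proof.
rewrite mderivX mnm1E; case: eqP => [->|_]; last by rewrite scale0r.
by rewrite -{1}(add0m U_(k)%MM) addmK mpolyX0 scale1r.
Qed.

Lemma mderiv_lin_subst g p i :
  (lin_subst g p)^`M(i) = \sum_(k < n) g k i *: lin_subst g p^`M(k).
Proof.
elim/mpoly_ring_ind: p => [c|l|p q IHp IHq|p q IHp IHq].
- rewrite lin_substC mderivC big1 // => k _; by rewrite mderivC rmorph0 scaler0.
- rewrite lin_substX raddf_sum /=.
  under eq_bigr do rewrite mderivZ mderivXU.
  under [RHS]eq_bigr do rewrite mderivXU rmorph_nat.
  rewrite (bigD1 i) //= [in RHS](bigD1 l) //= !eqxx.
  by rewrite !big1 // => k ki; rewrite ?[l == k]eq_sym (negPf ki) scaler0.
- rewrite rmorphD mderivD IHp IHq -big_split; apply: eq_bigr => k _ /=.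
  by rewrite mderivD rmorphD scalerDr.
- rewrite rmorphM mderivM IHp IHq mulr_suml mulr_sumr -big_split; apply: eq_bigr => k _ /=.
  by rewrite mderivM rmorphD !rmorphM scalerDr scalerAl scalerAr.
Qed.

End LinearSubstitution.

Lemma map_lin_subst (A B : comNzRingType) n (f : {rmorphism A -> B}) (g : 'M[A]_n) p :
  map_mpoly f (lin_subst g p) = lin_subst (map_mx f g) (map_mpoly f p).
Proof.
apply: (@mpoly_rmorph_ext _ _ _ (map_mpoly f \o lin_subst g)
  (lin_subst (map_mx f g) \o map_mpoly f)) => [c|i] /=.
  by rewrite lin_substC !map_mpolyC lin_substC.
rewrite map_mpolyX !lin_substX rmorph_sum; apply: eq_bigr => k _ /=.
by rewrite map_mpolyZ map_mpolyX mxE.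
Qed.

(** * The Hilbert-Mumford criterion *)

(** [pos x] means $x\ge 0$ for a total preorder: [V] will be a lattice of exponents with [pos]
    pulled back from the value group, so distinct weights may be equivalent. [pos_saturated] stands
    in for division by positive integers. *)
Record ordered_weights (V : zmodType) (n : nat) (lam : 'I_n.+1 -> V) (pos : V -> Prop) : Prop :=
  OrderedWeights {
    pos_add : forall x y, pos x -> pos y -> pos (x + y);
    pos_total : forall x, pos x \/ pos (- x);
    pos_saturated : forall x k, pos (x *+ k.+1) -> pos x;
    weights_sorted : forall i k : 'I_n.+1, (i <= k)%N -> pos (lam k - lam i);
    weights_sum : pos (- \sum_i lam i);
    weights_neg : ~ pos (lam ord0)
  }.

(* [lam i] plays the role of the i-th weight of a one-parameter subgroup, with values in an
   ordered abelian group; all monomials of [f] in suitable coordinates have weight at least 0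
   (and more than 0 when [strict]). *)
Definition destabilized (C : fieldType) (n : nat) (strict : Prop) (f : {mpoly C[n.+1]}) :=
  exists (k k' : 'M[C]_n.+1) (V : zmodType) (lam : 'I_n.+1 -> V) (pos : V -> Prop),
  [/\ k *m k' = 1%:M, k' *m k = 1%:M, ordered_weights lam pos,
    forall m, m \in msupp (lin_subst k f) -> pos (\sum_i lam i *+ m i) &
    strict -> forall m, m \in msupp (lin_subst k f) -> ~ pos (- \sum_i lam i *+ m i)].

Lemma mpoly_lift (C K : fieldType) (O : comNzRingType) (j : {rmorphism O -> K})
    (phi : {rmorphism O -> C}) n (P : {mpoly K[n]}) (h : {mpoly C[n]}) :
  (forall m, exists y, j y = P@_m /\ phi y = h@_m) ->
  exists H, map_mpoly j H = P /\ map_mpoly phi H = h.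
Proof.
move=> /choice[y yP]; pose s := undup (msupp P ++ msupp h).
(* Lifts are kept only on the union of the two supports; elsewhere the chosen lifts of 0 could be
   nonzero infinitely often. *)
pose H : {mpoly O[n]} := \sum_(m <- s) y m *: 'X_[m].
have HE m : H@_m = if m \in s then y m else 0.
  rewrite raddf_sum /=; under eq_bigr do rewrite mcoeffZ mcoeffX.
  case: ifP => ms.
    rewrite (bigD1_seq m) ?undup_uniq //= eqxx mulr1 big1 ?addr0 // => m' m'm.
    by rewrite (negPf m'm) mulr0.
  rewrite big_seq big1 // => m' m's.
  by case: eqP m's => [->|]; rewrite ?ms ?mulr0.
have supp m : (m \in s) = (P@_m != 0) || (h@_m != 0).
  by rewrite mem_undup mem_cat !mcoeff_msupp.
exists H; split; apply/mpolyP => m; rewrite mcoeff_map_mpoly HE supp; have [Pm hm] := yP m.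
  case: ifPn => [_|]; first exact: Pm.
  by rewrite negb_or !negbK => /andP[/eqP-> _]; rewrite raddf0.
case: ifPn => [_|]; first exact: hm.
by rewrite negb_or !negbK => /andP[_ /eqP->]; rewrite raddf0.
Qed.

Section DestabilizingPlace.
Variables (C K : fieldType) (O : comNzRingType).
Variables (j : {rmorphism O -> K}) (phi : {rmorphism O -> C}).
Hypothesis plc : is_place j phi.

(** Otherwise the inverse of [x] lies in the maximal ideal although one of its powers is a unit. *)
Lemma integral_root x k : integral_elt j (x ^+ k.+1) -> integral_elt j x.
Proof.
case=> z zx; case: (place_total plc x) => [//|[y [yx y0]]].
have [x0|x0] := eqVneq x 0; first by rewrite x0; exact: integral0.
have : z * y ^+ k.+1 = 1.
  apply: (place_inj plc); rewrite rmorphM rmorphXn zx yx rmorph1 exprVn mulfV //.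
  by rewrite expf_neq0.
move/(congr1 phi); rewrite rmorphM rmorphXn y0 expr0n mulr0 rmorph1 => /eqP.
by rewrite eq_sym oner_eq0.
Qed.

(** From [g U = L' a], the coefficient of [m] in [L' F] times $a^m$ is the coefficient of [m] in
    [U H]. If the former survives in the residue field it is a unit, so $a^m$ is integral; when [h]
    is 0 the latter has residue 0, so $a^m$ is in the maximal ideal. If the first entry of [a] were
    integral, all would be, and so would [g]. *)
Lemma place_destabilized n (f h : {mpoly C[n.+1]}) (F H : {mpoly O[n.+1]}) (g : 'M[K]_n.+1) :
  map_mpoly phi F = f -> map_mpoly phi H = h ->
  lin_subst g (map_mpoly j F) = map_mpoly j H -> \det g = 1 ->
  ~ (exists B, map_mx j B = g) -> destabilized (h = 0) f.
Proof.
move=> phiF phiH gF detg nintg.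
have [|L [L' [U [U' [a [[LL L'L] [UU U'U] eqa a0 adiv]]]]]] := smith_normal_form plc (M := g).
  by rewrite detg oner_neq0.
have gU : g *m map_mx j U = map_mx j L' *m diag_mx a.
  by rewrite -eqa -mulmxA mulmxA -map_mxM L'L map_mx1 mul1mx.
have coefE (m : 'X_{1..n.+1}) : (\prod_i a 0 i ^+ m i) * j (lin_subst L' F)@_m = j (lin_subst U H)@_m.
  rewrite -!mcoeff_map_mpoly !map_lin_subst -coef_lin_subst_diag -gF.
  by rewrite !lin_subst_mul gU.
(* Weights are exponent vectors; one is nonnegative when the corresponding monomial [mon] in the
   diagonal entries is integral. *)
pose V : zmodType := {ffun 'I_n.+1 -> int}.
pose lam (i : 'I_n.+1) : V := [ffun k => (k == i)%:R].
pose mon (w : V) := \prod_i a 0 i ^ (w i).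
have monD v w : mon (v + w) = mon v * mon w.
  by rewrite -big_split; apply: eq_bigr => i _; rewrite ffunE expfzDr.
have mon1 : mon 0 = 1 by rewrite /mon big1 // => i _; rewrite ffunE expr0z.
have monN w : mon (- w) = (mon w)^-1.
  by apply: (mulIf (x := mon w)); rewrite -?monD ?addNr ?mon1 ?mulVf //;
     apply/prodf_neq0 => i _; rewrite expfz_neq0.
have monX w k : mon (w *+ k) = mon w ^+ k.
  by elim: k => [|k IH]; rewrite ?mulr0n ?mon1 // mulrS monD IH exprS.
have monlam i : mon (lam i) = a 0 i.
  rewrite /mon (bigD1 i) //= ffunE eqxx expr1z big1 ?mulr1 // => k ki.
  by rewrite ffunE (negPf ki) expr0z.
have monsum (m : 'X_{1..n.+1}) : mon (\sum_i lam i *+ m i) = \prod_i a 0 i ^+ m i.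
  rewrite (big_morph mon monD mon1); apply: eq_bigr => i _.
  by rewrite monX monlam.
have suppP m : m \in msupp (lin_subst (map_mx phi L') f) ->
    exists z, (\prod_i a 0 i ^+ m i) = j ((lin_subst U H)@_m * z).
  rewrite mcoeff_msupp -phiF -map_lin_subst mcoeff_map_mpoly => /(place_unit plc)[z cz].
  by exists z; rewrite rmorphM -coefE -mulrA -rmorphM cz rmorph1 mulr1.
exists (map_mx phi L'), (map_mx phi L), V, lam, (fun w => integral_elt j (mon w)); split.
- by rewrite -map_mxM L'L map_mx1.
- by rewrite -map_mxM LL map_mx1.
- split.
  + by move=> x y; rewrite monD; exact: integralM.
  + by move=> x; rewrite monN; exact: (integralV plc).
  + by move=> x k; rewrite monX; exact: integral_root.
  + by move=> i k ik; rewrite monD monN !monlam; exact: adiv.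
  (* The product of the diagonal entries is the unit $\det L\det U$, because $\det g=1$. *)
  + exists (\det L' * \det U'); rewrite monN.
    have -> : mon (\sum_i lam i) = j (\det L * \det U).
      transitivity (\det (diag_mx a)).
        rewrite det_diag (big_morph mon monD mon1); by apply: eq_bigr => i _; rewrite monlam.
      by rewrite -eqa !det_mulmx detg mulr1 !det_map_mx rmorphM.
    have dd : j (\det L' * \det U') * j (\det L * \det U) = 1.
      by rewrite -rmorphM mulrACA -!det_mulmx L'L U'U mulmx1 det1 rmorph1.
    have nz : j (\det L * \det U) != 0.
      by apply: contra_eq_neq dd => ->; rewrite mulr0 eq_sym oner_neq0.
    by apply: (mulIf nz); rewrite mulVf.
  + rewrite monlam => a0int; apply: nintg.
    have [|B Bj] := @integral_mx _ _ j _ _ (diag_mx a).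
      move=> i k; rewrite mxE; case: eqP => _; last by rewrite mulr0n; exact: integral0.
      rewrite mulr1n -(divfK (a0 ord0) (a 0 i)); apply: integralM => //.
      exact: adiv.
    exists (L' *m B *m U'); rewrite !map_mxM Bj -gU -mulmxA -map_mxM UU map_mx1 mulmx1 //.
- move=> m /suppP[z zE]; rewrite monsum zE; by eexists.
- move=> h0 m /suppP[z zE]; rewrite monN monsum zE => -[y].
  have phi0 : phi (lin_subst U H)@_m = 0.
    by rewrite -mcoeff_map_mpoly map_lin_subst phiH h0 rmorph0 mcoeff0.
  have prod0 : \prod_i a 0 i ^+ m i != 0.
    by apply/prodf_neq0 => i _; rewrite expf_neq0.
  move=> yE; have : y * ((lin_subst U H)@_m * z) = 1.
    by apply: (place_inj plc); rewrite rmorphM yE rmorph1 mulVf // -zE.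
  move/(congr1 phi); rewrite !rmorphM phi0 mul0r mulr0 rmorph1 => /eqP.
  by rewrite eq_sym oner_eq0.
Qed.

End DestabilizingPlace.

(** * Generic matrices over residue fields of rings of functions *)

Section FunctionRing.
Variables (T : pointedType) (C : fieldType).

Definition const_fun (c : C) : T -> C := fun _ => c.
Lemma const_fun_is_zmod : zmod_morphism const_fun. Proof. by []. Qed.
Lemma const_fun_is_monoid : monoid_morphism const_fun. Proof. by []. Qed.
HB.instance Definition _ := GRing.isZmodMorphism.Build C (T -> C) const_fun const_fun_is_zmod.
HB.instance Definition _ := GRing.isMonoidMorphism.Build C (T -> C) const_fun const_fun_is_monoid.

Definition eval_at (t : T) (a : T -> C) : C := a t.
Lemma eval_at_is_zmod t : zmod_morphism (eval_at t). Proof. by []. Qed.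
Lemma eval_at_is_monoid t : monoid_morphism (eval_at t). Proof. by []. Qed.
HB.instance Definition _ t := GRing.isZmodMorphism.Build (T -> C) C (eval_at t) (eval_at_is_zmod t).
HB.instance Definition _ t := GRing.isMonoidMorphism.Build (T -> C) C (eval_at t) (eval_at_is_monoid t).

(* A prime ideal of the ring of all functions to a field is maximal: the pointwise inverse of
   [a] inverts [a] modulo it. *)
Lemma residue_field_of_functions (Sigma : T -> Prop) (S : (T -> C) -> Prop) :
  S 1 -> (forall a b, S a -> S b -> S (a * b)) ->
  (forall a, S a -> exists t, Sigma t /\ a t != 0) ->
  exists (K : fieldType) (psi : {rmorphism (T -> C) -> K}),
    (forall a, (forall t, Sigma t -> a t = 0) -> psi a = 0) /\
    (forall a, S a -> psi a != 0).
Proof.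
move=> S1 SM Snz; pose I0 := fun a : T -> C => forall t, Sigma t -> a t = 0.
have I0ideal : is_ideal I0.
  split=> [//|x y Ix Iy t St|a x Ix t St].
    by rewrite -[LHS]/(x t + y t) Ix // Iy // addr0.
  by rewrite -[LHS]/(a t * x t) Ix // mulr0.
have [|Q [idQ I0Q SQ primeQ _]] := prime_avoiding I0ideal S1 SM.
  by move=> a /Snz[t [St at0]] /(_ t St) at00; rewrite at00 eqxx in at0.
have [||K [psi psiP]] := quotient_field idQ.
- exact: SQ.
- move=> a nQa; exists (fun t => (a t)^-1).
  have [|//|//] := primeQ a (1 - (fun t => (a t)^-1) * a); apply: I0Q => t _.
  rewrite -[LHS]/(a t * (1 - (a t)^-1 * a t)).
  have [->|at0] := eqVneq (a t) 0; first by rewrite mul0r.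
  by rewrite mulVf // subrr mulr0.
exists K, psi; split=> [a /I0Q/psiP//|a /SQ nQa].
by apply/eqP => /psiP.
Qed.

End FunctionRing.

Section HilbertMumford.
Variables (R : realType) (n d : nat) (f : {mpoly R[i][n.+1]}).
Notation C := (R[i]).
Notation N := n.+1.
Hypothesis homf : f \is d.-homog.

Let T : pointedType := HB.pack 'M[C]_N (isPointed.Build 'M[C]_N 0).
Let fA := map_mpoly (@const_fun T C) f.
(** The tautological matrix of coordinate functions; [eval_at t] specializes it to [t]. *)
Let G : 'M[T -> C]_N := \matrix_(i, k) (fun t : 'M[C]_N => t i k).

Let eval_f t : map_mpoly (eval_at t) fA = f.
Proof. by apply/mpolyP => m; rewrite !mcoeff_map_mpoly. Qed.

Let eval_G t : map_mx (eval_at t) G = t.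
Proof. by apply/matrixP => i k; rewrite !mxE. Qed.

Let coef_G m t : (lin_subst G fA)@_m t = (lin_subst t f)@_m.
Proof.
have <- : map_mpoly (eval_at t) (lin_subst G fA) = lin_subst t f.
  by rewrite map_lin_subst eval_G eval_f.
by move: (lin_subst G fA) => X; rewrite mcoeff_map_mpoly.
Qed.

Let det_G t : (\det G) t = \det t.
Proof.
by rewrite -[in RHS](eval_G t) det_map_mx; move: (\det G).
Qed.

Section Specialization.
Variables (K : fieldType) (psi : {rmorphism (T -> C) -> K}).

Let iota : {rmorphism C -> K} := psi \o @const_fun T C.

Lemma coef_lin_subst_generic m :
  (lin_subst (map_mx psi G) (map_mpoly iota f))@_m = psi (fun t => (lin_subst t f)@_m).
Proof.
have -> : map_mpoly iota f = map_mpoly psi fA.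
  by apply/mpolyP => m'; rewrite !mcoeff_map_mpoly.
rewrite -map_lin_subst mcoeff_map_mpoly; congr (psi _).
by apply/funext => t; exact: coef_G.
Qed.

(** A place extending [G0] makes the generic translate of [f] integral with reduction [h]. The last
    premise says that the generic matrix itself is not integral, so [place_destabilized] applies. *)
Lemma generic_destabilized (h : {mpoly C[N]}) (G0 : K * C -> Prop) :
  (forall a, (forall t, in_SL t -> a t = 0) -> psi a = 0) ->
  partial_morphism iota G0 ->
  (forall m, G0 (psi (fun t => (lin_subst t f)@_m), h@_m)) ->
  (forall (O : comNzRingType) (j : {rmorphism O -> K}) (phi : {rmorphism O -> C}),
     is_place j phi -> (forall x w, G0 (x, w) -> exists y, j y = x /\ phi y = w) ->
     (forall B, map_mx j B = map_mx psi G -> 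
        \det B = 1 -> lin_subst (map_mx phi B) f = h -> False)) ->
  destabilized (h = 0) f.
Proof.
move=> psiSL pmG0 G0h nint; have [O [j [phi [plc plcG0]]]] := exists_place pmG0.
have [|H [jH phiH]] := mpoly_lift (j := j) (phi := phi)
    (P := lin_subst (map_mx psi G) (map_mpoly iota f)) (h := h).
  by move=> m; rewrite coef_lin_subst_generic; apply: plcG0.
have [|F [jF phiF]] := mpoly_lift (j := j) (phi := phi) (P := map_mpoly iota f) (h := f).
  by move=> m; rewrite mcoeff_map_mpoly; apply: plcG0; case: pmG0 => + _ _ _; apply.
have detG : \det (map_mx psi G) = 1.
  rewrite det_map_mx; apply/eqP; rewrite -subr_eq0 -(rmorph1 psi) -rmorphB; apply/eqP.
  by apply: psiSL => t tSL; rewrite -[LHS]/((\det G) t - 1) det_G tSL subrr.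
apply: (place_destabilized plc phiF phiH _ detG); first by rewrite jF jH.
case=> B jB; apply: (nint _ _ _ plc plcG0 B jB).
  by apply: (place_inj plc); rewrite rmorph1 -detG -jB det_map_mx.
rewrite -phiF -map_lin_subst -phiH; congr map_mpoly; apply/mpolyP => m.
apply: (place_inj plc); rewrite -!mcoeff_map_mpoly; congr mcoeff.
by rewrite jH map_lin_subst jB jF.
Qed.

End Specialization.

(** As [h] is in the closure, a polynomial in the coefficients that is nonzero at [h] is nonzero
    somewhere on the orbit, and can be kept nonzero in [K]. Hence sending its value at the generic
    translate to its value at [h] is single-valued. An integral generic matrix would reduce to an
    element of SL taking [f] to [h]. *)
Lemma zclosure_destabilized h : zclosure d (Defs.orbit f) h -> ~ Defs.orbit f h -> destabilized (h = 0) f.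
Proof.
case=> homh cl norb.
pose k := #|{: 'X_{1..N < d.+1}}|; pose e (i : 'I_k) : 'X_{1..N} := bmnm (enum_val i).
pose cf (p : {mpoly C[N]}) : 'I_k -> C := fun i => p@_(e i).
pose fn (P : {mpoly C[k]}) : T -> C := fun t => P.@[cf (lin_subst t f)].
have fnD P Q : fn (P + Q) = fn P + fn Q by apply/funext => t; exact: mevalD.
have fnM P Q : fn (P * Q) = fn P * fn Q by apply/funext => t; exact: mevalM.
have fnC c : fn c%:MP = const_fun c by apply/funext => t; exact: mevalC.
have [|||K [psi [psi0 psiS]]] := @residue_field_of_functions T C (@in_SL R n)
    (fun a => exists P, P.@[cf h] != 0 /\ a = fn P).
- by exists 1; rewrite meval1 oner_neq0; split => //; rewrite -mpolyC1 fnC.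
- move=> _ _ [P [P0 ->]] [Q [Q0 ->]]; exists (P * Q).
  by rewrite mevalM mulf_neq0.
- move=> _ [P [P0 ->]]; apply: contrapT => /forallNP nt; case/eqP: P0.
  apply: (cl (fun p => P.@[cf p])); first by exists k, e, P.
  move=> _ [t [tSL ->]]; apply: contrapT => /eqP nz; apply: (nt t); split => //.
pose G0 (x : K * C) := exists P, x.1 = psi (fn P) /\ x.2 = P.@[cf h].
apply: (@generic_destabilized K psi h G0 psi0).
- split.
  + by move=> c; exists c%:MP; rewrite fnC mevalC.
  + move=> [x v] [y w] [P [/= -> ->]] [Q [/= -> ->]]; exists (P + Q).
    by split; rewrite /= ?fnD ?rmorphD ?mevalD.
  + move=> [x v] [y w] [P [/= -> ->]] [Q [/= -> ->]]; exists (P * Q).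
    by split; rewrite /= ?fnM ?rmorphM ?mevalM.
  + move=> w [P [/= /esym/eqP PK ->]]; apply: contraTeq PK => P0.
    by apply: psiS; exists P.
- move=> m; have [md|md] := ltnP (mdeg m) d.+1; last first.
    have mdd : mdeg m != d by rewrite gtn_eqF.
    exists 0; rewrite (dhomog_nemf_coeff homh mdd) rmorph0; split => //=.
    congr (psi _); apply/funext => t; rewrite /fn meval0.
    by rewrite (dhomog_nemf_coeff (dhomog_lin_subst t homf) mdd).
  exists 'X_(enum_rank (BMultinom md)); rewrite mevalXU /cf /e enum_rankK; split => //=.
  by congr (psi _); apply/funext => t; rewrite /fn mevalXU /cf /e enum_rankK.
- move=> O j phi plc _ B jB detB hB; apply: norb; exists (map_mx phi B); split; last by rewrite -hB.
  by rewrite /in_SL det_map_mx detB rmorph1.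
Qed.

(** Some matrix entry takes infinitely many values on the stabilizer, so it becomes a transcendental
    [u] in [K], while the generic translate of [f] is [f] itself. Sending $u^{-1}$ to 0 is then
    consistent and keeps [u] out of the valuation ring. *)
Lemma infinite_stabilizer_destabilized :
  ~ (exists s : seq 'M[C]_N, forall g, stabilizer f g -> g \in s) -> destabilized False f.
Proof.
move=> inf.
have [[i0 k0] uP] : exists p : 'I_N * 'I_N, forall q : {poly C}, q != 0 ->
    exists t, stabilizer f t /\ q.[t p.1 p.2] != 0.
  apply: contrapT => /forallNP fin; apply: inf.
  have /choice[r rP] : forall p : 'I_N * 'I_N, exists rs : seq C,
      forall t, stabilizer f t -> t p.1 p.2 \in rs.
    move=> p; have /existsNP[q /not_implyP[q0 /forallNP qP]] := fin p.
    have [rs qrs] := closed_field_poly_normal q; exists rs => t st.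
    rewrite -root_prod_XsubC -(rootZ _ _ (a := lead_coef q)) ?lead_coef_eq0 //.
    rewrite -qrs; apply: contrapT => /negP nr; apply: (qP t); split => //.
  pose V := flatten [seq r p | p <- enum (('I_N * 'I_N)%type : finType)].
  exists [seq \matrix_(i, k) nth 0 V (F (i, k)) | F : {ffun 'I_N * 'I_N -> 'I_(size V)}].
  move=> t st; have tV i k : t i k \in V.
    apply/flattenP; exists (r (i, k)); last exact: (rP (i, k)).
    by apply: map_f; rewrite mem_enum.
  have lt i k : (index (t i k) V < size V)%N by rewrite index_mem.
  apply/mapP; exists [ffun p => Ordinal (lt p.1 p.2)]; first by rewrite mem_enum.
  by apply/matrixP => i k; rewrite !mxE ffunE /= nth_index.
rewrite /= in uP.
have [|||K [psi [psi0 psiS]]] := @residue_field_of_functions T C (stabilizer f)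
    (fun a => exists q : {poly C}, q != 0 /\ a = fun t => q.[t i0 k0]).
- by exists 1; rewrite oner_neq0; split => //; apply/funext => t; rewrite hornerC.
- move=> _ _ [p [p0 ->]] [q [q0 ->]]; exists (p * q); rewrite mulf_neq0 //; split => //.
  by apply/funext => t; rewrite hornerM.
- by move=> _ [q [q0 ->]]; exact: uP.
pose iota : {rmorphism C -> K} := psi \o @const_fun T C.
pose uf : T -> C := fun t : 'M[C]_N => t i0 k0.
pose u : K := psi uf.
have psi_poly (q : {poly C}) : psi (fun t => q.[t i0 k0]) = (map_poly iota q).[u].
  have -> : (fun t : 'M[C]_N => q.[t i0 k0]) = (map_poly (@const_fun T C) q).[uf].
    apply/funext => t; rewrite -[RHS]/(eval_at (t : T) _) -horner_map -map_poly_comp.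
    by congr (_.[_]); apply/polyP => i; rewrite coef_map.
  by rewrite -horner_map -map_poly_comp.
have transc (q : {poly C}) : q != 0 -> (map_poly iota q).[u] != 0.
  by move=> q0; rewrite -psi_poly; apply: psiS; exists q.
have u0 : u != 0.
  by have := transc 'X; rewrite map_polyX hornerX; apply; rewrite polyX_eq0.
pose G0 (x : K * C) := exists q : {poly C}, x.1 = (map_poly iota q).[u^-1] /\ x.2 = q.[0].
have evD (p q : {poly C}) :
    (map_poly iota (p + q)).[u^-1] = (map_poly iota p).[u^-1] + (map_poly iota q).[u^-1].
  by rewrite rmorphD hornerD.
have evM (p q : {poly C}) :
    (map_poly iota (p * q)).[u^-1] = (map_poly iota p).[u^-1] * (map_poly iota q).[u^-1].
  by rewrite rmorphM hornerM.
have pmG0 : partial_morphism iota G0.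
  split.
  + by move=> c; exists c%:P; rewrite map_polyC !hornerC.
  + move=> [x v] [y w] [p [/= -> ->]] [q [/= -> ->]]; exists (p + q).
    by split; [exact/esym/evD | exact/esym/hornerD].
  + move=> [x v] [y w] [p [/= -> ->]] [q [/= -> ->]]; exists (p * q).
    by split; [exact/esym/evM | exact/esym/hornerM].
  + move=> w [q [/= /esym qu ->]]; apply/eqP; apply: contraPT qu => q0.
    (* [r] reverses [q]: a [q] with $q(u^{-1})=0$ and $q(0)\ne 0$ would give a nonzero polynomial
       vanishing at [u]. *)
    pose r : {poly C} := \poly_(i < size q) q`_((size q).-1 - i).
    have sq : (0 < size q)%N.
      by rewrite lt0n size_poly_eq0; apply: contraNneq q0 => ->; rewrite horner0.
    have r0 : r != 0.
      apply: contraNneq q0 => /(congr1 (fun p : {poly C} => p`_((size q).-1))).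
      by rewrite coef_poly prednK // leqnn subnn coef0 horner_coef0 => ->.
    apply/eqP; apply: contraNneq (transc _ r0) => qu.
    have -> : (map_poly iota r).[u] = u ^+ (size q).-1 * (map_poly iota q).[u^-1]; last by rewrite qu mulr0.
    rewrite (@horner_coef_wide _ (size q)); last by rewrite size_map_poly size_poly.
    rewrite horner_coef size_map_poly mulr_sumr (reindex_inj rev_ord_inj); apply: eq_bigr => i _.
    have iq : (i <= (size q).-1)%N by rewrite -ltnS prednK.
    have -> : (rev_ord i : nat) = ((size q).-1 - i)%N by rewrite /=; lia.
    rewrite !coef_map coef_poly subKn // mulrCA expfB_cond ?(negPf u0) // exprVn.
    by have -> : ((size q).-1 - i < size q)%N by lia.
have SL0 (a : T -> C) : (forall t, in_SL t -> a t = 0) -> psi a = 0.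
  by move=> a0; apply: psi0 => t [tSL _]; exact: a0.
have [||k [k' [V [lam [pos [kk k'k ow supp _]]]]]] := @generic_destabilized K psi f G0 SL0 pmG0.
- move=> m; exists (f@_m)%:P; rewrite map_polyC !hornerC; split => //=.
  apply/eqP; rewrite -subr_eq0 -rmorphB; apply/eqP; apply: psi0 => t [_ tf].
  by rewrite -[LHS]/((lin_subst t f)@_m - f@_m) -{2}tf subrr.
- move=> O j phi plc plcG0 B jB _ _.
  have [|y [jy phiy]] := plcG0 u^-1 0; first by exists 'X; rewrite map_polyX !hornerX.
  have : y * B i0 k0 = 1.
    apply: (place_inj plc); rewrite rmorphM rmorph1 jy.
    have -> : j (B i0 k0) = u by move/matrixP/(_ i0 k0): jB; rewrite !mxE.
    by rewrite mulVf.
  move/(congr1 phi); rewrite rmorphM phiy mul0r rmorph1 => /eqP.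
  by rewrite eq_sym oner_eq0.
by exists k, k', V, lam, pos; split.
Qed.

End HilbertMumford.

(** * Inequalities between weights *)

Section Weights.
Variables (V : zmodType) (n : nat) (lam : 'I_n.+1 -> V) (pos : V -> Prop).
Hypothesis ow : ordered_weights lam pos.

Let posD x y : pos x -> pos y -> pos (x + y). Proof. exact: (pos_add ow). Qed.

Let pos0 : pos 0. Proof. by case: (pos_total ow 0); rewrite ?oppr0. Qed.

Let posMn x k : pos x -> pos (x *+ k).
Proof. by move=> px; elim: k => [|k IH]; rewrite ?mulr0n // mulrS; apply: posD. Qed.

Let pos_sum (I : Type) (r : seq I) (P : pred I) (F : I -> V) :
  (forall i, P i -> pos (F i)) -> pos (\sum_(i <- r | P i) F i).
Proof. by move=> PF; apply: big_ind. Qed.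

Let posN x : ~ pos x -> pos (- x). Proof. by case: (pos_total ow x). Qed.

(** All weights are at least [lam ord0] and their sum is at most 0. This serves the case $s=n-1$. *)
Lemma top_weight_bound : pos (- (lam ord0 *+ n) - lam ord_max).
Proof.
have -> : - (lam ord0 *+ n) - lam ord_max =
    - (\sum_i lam i) + \sum_(i < n) (lam (widen_ord (leqnSn n) i) - lam ord0).
  rewrite sumrB sumr_const card_ord big_ord_recr /= opprD.
  by rewrite addrACA addNr add0r addrC.
by apply: posD; [exact: (weights_sum ow) | apply: pos_sum => i _; exact: (weights_sorted ow)].
Qed.

(* With [p k] the positive part of [lam k] and [tau] the reflection of the indices above [s],
   [(d-1) lam k + p (tau k) - p k >= (d-2) p k] for [k > s]; sum over all [k]. *)
Lemma singular_weight_bound (s d : nat) : (s < n)%N -> (2 <= d)%N ->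
  (forall k l : 'I_n.+1, (s < k)%N -> (l = n.+1 + s - k :> nat)%N -> ~ pos (lam k) ->
     pos (lam l + lam k *+ (d - 1))) ->
  pos (- (lam ord0 *+ ((d - 1) * s.+1)) - lam ord_max *+ (d - 2)).
Proof.
move=> sn d2 sing.
pose p k := if `[< pos (lam k) >] then lam k else 0.
have ppos k : pos (p k) by rewrite /p; case: asboolP.
have pge k : pos (p k - lam k).
  by rewrite /p; case: asboolP => [_|/posN]; rewrite ?subrr // sub0r.
pose tau (k : 'I_n.+1) : 'I_n.+1 := if (s < k)%N then inord (n.+1 + s - k) else k.
have tauE (k : 'I_n.+1) : (s < k)%N -> tau k = (n.+1 + s - k)%N :> nat.
  by move=> sk; rewrite /tau sk inordK //; lia.
have tau_id (k : 'I_n.+1) : (k <= s)%N -> tau k = k by rewrite /tau leqNgt => /negPf->.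
have tauP (k : 'I_n.+1) : (s < tau k)%N = (s < k)%N.
  have [sk|sk] := ltnP s k; last by rewrite tau_id // ltnNge sk.
  by rewrite tauE //; have := ltn_ord k; lia.
have tauK : involutive tau.
  move=> k; apply/val_inj => /=; have [sk|sk] := ltnP s k.
    by rewrite tauE ?tauP // tauE //; have := ltn_ord k; lia.
  by rewrite !tau_id.
have key (k : 'I_n.+1) : (s < k)%N ->
    pos (lam k *+ (d - 1) + (p (tau k) - p k) - p k *+ (d - 2)).
  move=> sk; rewrite {2 3}/p; case: asboolP => [pk|npk].
    have -> : lam k *+ (d - 1) + (p (tau k) - lam k) - lam k *+ (d - 2) = p (tau k); last exact: ppos.
    have -> : (d - 1 = (d - 2).+1)%N by lia.
    by rewrite mulrS (addrC (lam k)) addrACA subrr addr0 addrAC subrr add0r.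
  rewrite subr0 mul0rn subr0.
  have -> : lam k *+ (d - 1) + p (tau k) = (lam (tau k) + lam k *+ (d - 1)) + (p (tau k) - lam (tau k)).
    by rewrite [RHS]addrC addrA subrK addrC.
  by apply: posD => //; apply: sing => //; exact: tauE.
have ptau : \sum_(k < n.+1 | (s < k)%N) (p (tau k) - p k) = 0.
  rewrite sumrB (reindex_inj (inv_inj tauK)) /=; under eq_bigl do rewrite tauP.
  by under eq_bigr do rewrite tauK; rewrite subrr.
pose low := \sum_(k < n.+1 | ~~ (s < k)%N) (lam k - lam ord0).
pose high := \sum_(k < n.+1 | (s < k)%N) (lam k *+ (d - 1) + (p (tau k) - p k) - p k *+ (d - 2)).
pose rest := \sum_(k < n.+1 | (s < k)%N && (k != ord_max)) p k.
have lowE : low = \sum_(k < n.+1 | ~~ (s < k)%N) lam k - lam ord0 *+ s.+1.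
  rewrite /low sumrB; congr (_ - _); under eq_bigl do rewrite -leqNgt -ltnS.
  have sn1 : (s.+1 <= n.+1)%N by lia.
  by rewrite (big_ord_narrow sn1) sumr_const card_ord.
have highE : high = (\sum_(k < n.+1 | (s < k)%N) lam k) *+ (d - 1) - (p ord_max + rest) *+ (d - 2).
  rewrite /high sumrB big_split /= ptau addr0 !sumrMnl; congr (_ - _ *+ _).
  by rewrite (bigD1 ord_max).
have sumE : \sum_i lam i = \sum_(k < n.+1 | (s < k)%N) lam k + \sum_(k < n.+1 | ~~ (s < k)%N) lam k.
  exact: bigID.
(* Five nonnegative terms: the summed [key] inequalities, the weights up to index [s] compared with
   the least one, minus the sum of all weights, the positive parts to be discarded, and the last
   positive part compared with [lam ord_max]. *)
have -> : - (lam ord0 *+ ((d - 1) * s.+1)) - lam ord_max *+ (d - 2) =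
    high + low *+ (d - 1) + (- \sum_i lam i) *+ (d - 1) + rest *+ (d - 2) +
    (p ord_max - lam ord_max) *+ (d - 2).
  rewrite highE lowE sumE mulnC mulrnA !(mulrnDl, mulNrn).
  set l := lam ord0 *+ _ *+ _; set x := (\sum_(_ | _) _) *+ (d - 1); set y := (\sum_(_ | _) _) *+ (d - 1).
  set q := p ord_max *+ _; set r := rest *+ _; set z := lam ord_max *+ _.
  rewrite (addrACA x _ y) [X in X + r]addrAC subrr add0r opprD.
  by rewrite [X in X + (q - z)]addrAC subrK addrACA addNr add0r.
do ?apply: posD.
- by apply: pos_sum => k /key.
- by apply: posMn; apply: pos_sum => k _; exact: (weights_sorted ow).
- by apply: posMn; exact: (weights_sum ow).
- by apply: posMn; apply: pos_sum.
- exact: posMn.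
Qed.

(** Replacing every weight but the first by the largest bounds the weight of [m] by
    $m_0\lambda_0+(|m|-m_0)\lambda_n$. Eliminating $\lambda_n$ leaves a multiple of $\lambda_0<0$,
    whose coefficient cannot be positive, nor zero if the weight is positive. *)
Lemma weight_multiplicity_bound (m : 'X_{1..n.+1}) (c e : nat) : (0 < e)%N ->
  pos (- (lam ord0 *+ c) - lam ord_max *+ e) -> pos (\sum_i lam i *+ m i) ->
  (m ord0 * e <= (mdeg m - m ord0) * c)%N /\
  (~ pos (- \sum_i lam i *+ m i) -> (m ord0 * e < (mdeg m - m ord0) * c)%N).
Proof.
move=> e0 posb posm; pose x := lam ord0 *+ m ord0 + lam ord_max *+ (mdeg m - m ord0).
set b := (X in pos X) in posb; set w := \sum_i _ in posm *.
have xw : pos (x - w).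
  have -> : x - w = \sum_(i < n) (lam ord_max - lam (lift ord0 i)) *+ m (lift ord0 i).
    rewrite /x /w big_ord_recl opprD addrACA subrr add0r.
    rewrite mdegE big_ord_recl addnC addnK -sumrMnr -sumrB.
    by apply: eq_bigr => i _; rewrite mulrnBl.
  by apply: pos_sum => i _; apply: posMn; apply: (weights_sorted ow); rewrite -ltnS.
have xpos : pos x by rewrite -(subrK w x); apply: posD.
set m' := (mdeg m - m ord0)%N.
have comb k : (m ord0 * e = m' * c + k)%N -> x *+ e + b *+ m' = lam ord0 *+ k.
  move=> ek; rewrite /x /b mulrnDl mulrnBl mulNrn -!mulrnA (mulnC e) addrACA subrr addr0.
  by rewrite ek (mulnC c) mulrnDr addrAC subrr add0r.
split.
  rewrite leqNgt; apply/negP => lt; apply: (weights_neg ow).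
  apply: (@pos_saturated _ _ _ _ ow _ (m ord0 * e - m' * c).-1).
  by rewrite prednK ?subn_gt0 // -comb ?subnKC ?(ltnW lt) //; apply: posD; apply: posMn.
move=> nw; rewrite ltnNge; apply/negP => le; apply: nw.
have nx : pos (- x).
  apply: (@pos_saturated _ _ _ _ ow _ e.-1); rewrite prednK //.
  have -> : (- x) *+ e = b *+ m' + (- lam ord0) *+ (m ord0 * e - m' * c).
    by rewrite !mulNrn -comb ?subnKC // opprD addrCA subrr addr0.
  by apply: posD; apply: posMn; [exact: posb | apply: posN; exact: (weights_neg ow)].
have -> : - w = - x + (x - w) by rewrite addKr.
exact: posD.
Qed.
End Weights.

(** * Counting argument for common zeros of forms *)

Section OrderAtOrigin.
Variables (A : comNzRingType) (n : nat).
Implicit Types (p q : {mpoly A[n]}).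

Definition vanishes_to (k : nat) p := forall m, (mdeg m < k)%N -> p@_m = 0.

Lemma vanishes_to0 k : vanishes_to k 0. Proof. by move=> m _; rewrite mcoeff0. Qed.

Lemma vanishes_to_any p : vanishes_to 0 p. Proof. by []. Qed.

Lemma vanishes_toD k p q : vanishes_to k p -> vanishes_to k q -> vanishes_to k (p + q).
Proof. by move=> pk qk m mk; rewrite mcoeffD pk ?qk ?addr0. Qed.

Lemma vanishes_toZ k c p : vanishes_to k p -> vanishes_to k (c *: p).
Proof. by move=> pk m mk; rewrite mcoeffZ pk ?mulr0. Qed.

Lemma vanishes_to_sum k (I : Type) (r : seq I) (P : pred I) (F : I -> {mpoly A[n]}) :
  (forall i, P i -> vanishes_to k (F i)) -> vanishes_to k (\sum_(i <- r | P i) F i).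
Proof. by move=> Fk; apply: big_ind => // [|p q]; [exact: vanishes_to0 | exact: vanishes_toD]. Qed.

Lemma vanishes_toM k l p q : vanishes_to k p -> vanishes_to l q -> vanishes_to (k + l) (p * q).
Proof.
move=> pk ql m mkl; rewrite mcoeffM big1 // => -[m1 m2] /= /eqP me.
have [lt|ge] := ltnP (mdeg m1) k; first by rewrite pk ?mul0r.
by rewrite ql ?mulr0 //; have := congr1 mdeg me; rewrite mdegD; lia.
Qed.

Lemma vanishes_toX k p e : vanishes_to k p -> vanishes_to (k * e) (p ^+ e).
Proof.
move=> pk; elim: e => [|e IH]; first by rewrite muln0.
by rewrite exprS mulnS; apply: vanishes_toM.
Qed.

Lemma vanishes_to_prod (I : finType) (F : I -> {mpoly A[n]}) (k b : I -> nat) :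
  (forall i, vanishes_to (k i) (F i)) ->
  vanishes_to (\sum_i k i * b i) (\prod_i F i ^+ b i).
Proof.
move=> Fk; apply: (big_ind2 (fun e q => vanishes_to e q)) => //.
- by move=> e p e' q; exact: vanishes_toM.
- by move=> i _; exact: vanishes_toX.
Qed.

Lemma dhomog_vanishes_to p d : p \is d.-homog -> vanishes_to d p.
Proof. by move=> hp m md; rewrite (dhomog_nemf_coeff hp) //= ltn_eqF. Qed.

End OrderAtOrigin.

Lemma linear_dependence (K : fieldType) (I J : finType) (M : I -> J -> K) :
  (#|J| < #|I|)%N ->
  exists v : I -> K, (exists i, v i != 0) /\ forall k, \sum_i v i * M i k = 0.
Proof.
move=> JI; pose B := \matrix_(i < #|I|, k < #|J|) M (enum_val i) (enum_val k).
have : kermx B != 0.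
  rewrite -mxrank_eq0 mxrank_ker subn_eq0 -ltnNge.
  exact: leq_ltn_trans (rank_leq_col B) JI.
case/rowV0Pn => w /sub_kermxP wB w0.
exists (fun i => w 0 (enum_rank i)); split.
  apply: contrapT => /forallNP h; case/eqP: w0; apply/rowP => i; rewrite mxE.
  by have := h (enum_val i); rewrite enum_valK => /negP/negPn/eqP.
move=> k; rewrite (reindex_onto enum_val enum_rank) => [|i _]; last by rewrite enum_rankK.
have := congr1 (fun X : 'rV_ _ => X 0 (enum_rank k)) wB; rewrite !mxE => {2}<-.
apply: eq_big => [i|i _]; first by rewrite enum_valK eqxx.
by rewrite mxE enum_valK enum_rankK.
Qed.

Lemma multinom_split n (m : 'X_{1..n}) a : (a <= mdeg m)%N ->
  exists m1 m2, m = (m1 + m2)%MM /\ mdeg m1 = a.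
Proof.
elim: a => [|a IH] am; first by exists 0%MM, m; rewrite add0m mdeg0.
have [m1 [m2 [me m1a]]] := IH (ltnW am).
have m20 : m2 != 0%MM.
  by apply: contraTneq am => m20; rewrite me m20 addm0 m1a ltnn.
have [i m2i] : exists i, m2 i != 0%N.
  apply: contrapT => /forallNP h; case/eqP: m20; apply/mnmP => i; rewrite mnm0E.
  by apply/eqP; move/negP/negPn: (h i).
exists (m1 + U_(i))%MM, (m2 - U_(i))%MM; rewrite mdegD m1a mdeg1 addn1; split => //.
by rewrite me -addmA [(U_(i) + _)%MM]addmC submK // lep1mP.
Qed.

Section Counting.
Variables (K : fieldType) (n k : nat) (F : 'I_k -> {mpoly K[n]}) (N : nat).
Hypotheses (kn : (k < n)%N) (F1 : forall i, vanishes_to 1 (F i)).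
Hypothesis FN : forall m : 'X_{1..n}, mdeg m = N -> exists w, 'X_[m] = \sum_i w i * F i.

Let small_part (p : {mpoly K[n]}) : exists (c : 'X_{1..n < N} -> K) (q : 'I_k -> {mpoly K[n]}),
  p = \sum_m c m *: 'X_[m] + \sum_i q i * F i.
Proof.
elim/mpolyind: p => [|c m p _ _ [d [q ->]]].
  by exists (fun=> 0), (fun=> 0); rewrite !big1 ?addr0 // => i _; rewrite ?scale0r ?mul0r.
have [mN|Nm] := ltnP (mdeg m) N.
  exists (fun m' => d m' + if m' == BMultinom mN then c else 0), q.
  rewrite addrA; congr (_ + _); under [RHS]eq_bigr do rewrite scalerDl.
  rewrite big_split addrC; congr (_ + _).
  rewrite (bigD1 (BMultinom mN)) //= eqxx big1 ?addr0 // => m' /negPf->.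
  by rewrite scale0r.
have [m1 [m2 [-> /FN[w wE]]]] := multinom_split Nm.
exists d, (fun i => c *: 'X_[m2] * w i + q i).
have -> : \sum_i (c *: 'X_[m2] * w i + q i) * F i = c *: 'X_[m1 + m2] + \sum_i q i * F i.
  under eq_bigr do rewrite mulrDl -mulrA.
  by rewrite big_split -mulr_sumr -wE /= -scalerAl -mpolyXD addmC.
by rewrite addrCA.
Qed.

Section Spanning.
Variable D : nat.

Let Box : finType := ('X_{1..n < N} * {ffun 'I_k -> 'I_D})%type.
Let E (x : Box) : {mpoly K[n]} := 'X_[x.1] * \prod_i F i ^+ x.2 i.

Let W (p : {mpoly K[n]}) := exists c : Box -> K, vanishes_to D (p - \sum_x c x *: E x).

Let WD p q : W p -> W q -> W (p + q).
Proof.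
case=> c cp [d dq]; exists (fun x => c x + d x).
under eq_bigr do rewrite scalerDl.
by rewrite big_split opprD addrACA; apply: vanishes_toD.
Qed.

Let WZ a p : W p -> W (a *: p).
Proof.
case=> c cp; exists (fun x => a * c x); under eq_bigr do rewrite -scalerA.
by rewrite -scaler_sumr -scalerBr; apply: vanishes_toZ.
Qed.

Let Wvan p : vanishes_to D p -> W p.
Proof. by exists (fun=> 0); rewrite big1 ?subr0 // => x _; rewrite scale0r. Qed.

Let Wsum (I : Type) (r : seq I) (H : I -> {mpoly K[n]}) :
  (forall i, W (H i)) -> W (\sum_(i <- r) H i).
Proof. by move=> WH; apply: big_ind => //; apply: Wvan; exact: vanishes_to0. Qed.

Let W_power L (b : 'I_k -> nat) p : (L + \sum_i b i = D)%N -> W (p * \prod_i F i ^+ b i).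
Proof.
elim: L b p => [|L IH] b p Lb.
  apply: Wvan; rewrite -[D]add0n; apply: vanishes_toM => //.
  rewrite -Lb add0n; under eq_bigr do rewrite -[b _]mul1n.
  exact: (vanishes_to_prod (k := fun=> 1%N)).
have [c [q ->]] := small_part p; rewrite mulrDl; apply: WD.
  rewrite mulr_suml; apply: Wsum => m; rewrite -scalerAl; apply: WZ.
  have bD i : (b i < D)%N by rewrite -Lb (bigD1 i) //=; lia.
  pose x0 : Box := (m, [ffun i => Ordinal (bD i)]).
  exists (fun x => (x == x0)%:R); rewrite (bigD1 x0) //= eqxx scale1r.
  rewrite [X in E x0 + X]big1 ?addr0 => [|x /negPf->]; last by rewrite scale0r.
  rewrite /E /=; under [X in _ - _ * X]eq_bigr do rewrite ffunE.
  by rewrite subrr; exact: vanishes_to0.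
rewrite mulr_suml; apply: Wsum => i.
have -> : q i * F i * \prod_l F l ^+ b l = q i * \prod_l F l ^+ (b l + (l == i)).
  rewrite -mulrA; congr (_ * _); rewrite (bigD1 i) //= [in RHS](bigD1 i) //= eqxx addn1 exprS mulrA.
  by congr (_ * _); apply: eq_bigr => l /negPf->; rewrite addn0.
apply: IH; rewrite big_split /=; suff -> : (\sum_(l < k) (l == i) = 1)%N by rewrite addn1 addnS -addSn.
by rewrite (bigD1 i) //= eqxx big1 // => l /negPf->.
Qed.

(** Modulo the [F i] every polynomial is a combination of the monomials of degree less than [N].
    Applying this again to the cofactors of the [F i], [D] times in all, leaves products of [D] of
    the [F i], which vanish to order [D]. *)
Lemma spanning (p : {mpoly K[n]}) :
  exists c : ('X_{1..n < N} * {ffun 'I_k -> 'I_D}) -> K,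
    vanishes_to D (p - \sum_x c x *: ('X_[x.1] * \prod_i F i ^+ x.2 i)).
Proof.
have := @W_power D (fun=> 0%N) p; rewrite big1 // addn0 => /(_ erefl).
by rewrite big1 ?mulr1.
Qed.

End Spanning.

(* Modulo the D-th power of the maximal ideal at the origin there are about D^n monomials,
   but only O(D^k) products spanning the quotient. *)
Lemma few_forms_contradiction : False.
Proof.
(* There are $a(nD')^k$ spanning products, fewer than $D'^{k+1}\le D'^n$, the number of monomials
   with all exponents below [D']; these have degree below [D]. *)
pose a := #|{: 'X_{1..n < N}}|; pose D' := (a * n ^ k).+1; pose D := (n * D')%N.
pose mon (b : {ffun 'I_n -> 'I_D'}) : 'X_{1..n} := [multinom (b i : nat) | i < n].
have mon_inj : injective mon.
  move=> b b' /mnmP e; apply/ffunP => i; apply/val_inj.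
  by have := e i; rewrite !mnmE.
have monD b : (mdeg (mon b) < D)%N.
  rewrite mdegE; apply: (@leq_ltn_trans (\sum_(i < n) (a * n ^ k))%N).
    by apply: leq_sum => i _; rewrite mnmE -ltnS.
  by rewrite sum_nat_const card_ord /D /D'; nia.
have /choice[c cP] := fun b => spanning D 'X_[mon b].
have [|v [[b0 vb0] vc]] := linear_dependence c.
  rewrite card_prod !card_ffun !card_ord -/a /D expnMn mulnA.
  apply: (@leq_trans (D' ^ k.+1)); last by apply: leq_pexp2l.
  by rewrite expnS ltn_pmul2r // expn_gt0.
case/eqP: vb0.
have : vanishes_to D (\sum_b v b *: 'X_[mon b]).
  have -> : \sum_b v b *: 'X_[mon b] = \sum_b v b *: ('X_[mon b] - 
      \sum_x c b x *: ('X_[x.1] * \prod_i F i ^+ x.2 i)).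
    under [RHS]eq_bigr do rewrite scalerBr scaler_sumr.
    rewrite sumrB exchange_big /= [X in _ - X]big1 ?subr0 // => x _.
    under eq_bigr do rewrite scalerA.
    by rewrite -scaler_suml vc scale0r.
  by apply: vanishes_to_sum => b _; apply: vanishes_toZ.
move=> /(_ _ (monD b0)); rewrite raddf_sum /= (bigD1 b0) //= mcoeffZ mcoeffX eqxx mulr1.
rewrite big1 ?addr0 // => b bb0.
by rewrite mcoeffZ mcoeffX (inj_eq mon_inj) (negPf bb0) mulr0.
Qed.

End Counting.

(** * Nullstellensatz *)

Section Nullstellensatz.
Variables (R : realType) (n : nat).
Notation C := (R[i]).
Notation S := {mpoly C[n]}.

Lemma ideal_unit (J : S -> Prop) c : is_ideal J -> c != 0 -> J c%:MP -> J 1.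
Proof.
case=> _ _ JM c0 Jc; have := JM (c^-1)%:MP _ Jc.
by rewrite -mpolyCM mulVf // mpolyC1.
Qed.

Lemma prime_root (Q : S -> Prop) (x : S) (b : {poly C}) :
  is_ideal Q -> ~ Q 1 -> (forall p q, Q (p * q) -> Q p \/ Q q) ->
  b != 0 -> Q (map_poly (@mpolyC n C) b).[x] -> exists c, Q (x - c%:MP).
Proof.
move=> idQ Q1 Qprime b0; have [rs ->] := closed_field_poly_normal b.
rewrite map_polyZ hornerZ => /Qprime[/(ideal_unit idQ)|].
  by rewrite lead_coef_eq0 => /(_ b0).
rewrite rmorph_prod; elim: rs => [|c rs IH]; first by rewrite big_nil hornerC => /Q1.
rewrite big_cons hornerM => /Qprime[|/IH//].
by rewrite rmorphB /= map_polyX map_polyC hornerXsubC; exists c.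
Qed.

(* The inverses of [x - c] modulo [Q], for uncountably many [c], would be linearly
   independent in a space of countable dimension. *)
Lemma maximal_ideal_coordinate (Q : S -> Prop) (G x : S) :
  is_ideal Q -> (forall N, ~ Q (G ^+ N)) -> (forall p q, Q (p * q) -> Q p \/ Q q) ->
  (forall a, ~ Q a -> exists N u, Q (G ^+ N - u * a)) ->
  exists c, Q (x - c%:MP).
Proof.
move=> idQ QG Qprime Qmax; apply: contrapT => /forallNP nc.
have Q1 : ~ Q 1 by rewrite -(expr0 G).
pose inv N s (c : R) (u : S) := (msize u <= s)%N /\ Q (G ^+ N - u * (x - (c%:C)%C%:MP)).
(* Pairs of an exponent [N] and a size bound [s] are countable in number, so infinitely many real
   [c] share one pair. *)
have [k kP] := @uncountable_cover R (fun k c => exists N s u, k = pickle (N, s) /\ inv N s c u)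
  (fun c => let: ex_intro N (ex_intro u Qu) := Qmax _ (nc (c%:C)%C) in
     ex_intro _ (pickle (N, msize u))
       (ex_intro _ N (ex_intro _ (msize u) (ex_intro _ u (conj erefl (conj (leqnn _) Qu)))))).
have [N [s Ns]] : exists N s : nat, k = pickle (N, s).
  by have [c [[N [s [u [-> _]]]] _]] := kP [::]; exists N, s.
have inf K : exists cs : seq R, [/\ size cs = K, uniq cs & forall c, c \in cs -> exists u, inv N s c u].
  elim: K => [|K [cs [szcs ucs csP]]]; first by exists [::].
  have [c [[N' [s' [u [/esym e iu]]]] ccs]] := kP cs; exists (c :: cs); split => //=.
  - by rewrite szcs.
  - by rewrite ccs.
  - move=> c'; rewrite inE => /orP[/eqP->|/csP//]; exists u.
    by move: e; rewrite Ns => /(pcan_inj pickleK)[<- <-].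
pose K := #|{: 'X_{1..n < s}}|.+1.
have [cs [szcs ucs csP]] := inf K.
pose c (i : 'I_K) := nth 0 cs i.
have cinj : injective c.
  by move=> i l /eqP; rewrite nth_uniq ?szcs // => /eqP/val_inj.
have /choice[u uP] : forall i, exists u, inv N s (c i) u.
  by move=> i; apply: csP; rewrite mem_nth ?szcs.
have [|v [[i0 vi0] vu]] := @linear_dependence C 'I_K {: 'X_{1..n < s}} (fun i m => (u i)@_m).
  by rewrite card_ord.
have {}vu : \sum_i v i *: u i = 0.
  apply/mpolyP => m; rewrite mcoeff0 raddf_sum /=.
  have [ms|ms] := ltnP (mdeg m) s.
    by rewrite -[RHS](vu (BMultinom ms)); apply: eq_bigr => i _; rewrite mcoeffZ.
  rewrite big1 // => i _; rewrite mcoeffZ memN_msupp_eq0 ?mulr0 //.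
  by apply: msize_mdeg_ge; apply: leq_trans ms; case: (uP i).
(* Modulo [Q], [u i] stands for $G^N/(x-c_i)$; clearing denominators in the linear relation gives
   $b(x)G^N\in Q$. The value of [b] at [c i0] is [v i0] times a nonzero product. *)
pose b : {poly C} := \sum_i v i *: \prod_(l | l != i) ('X - ((c l)%:C)%C%:P).
have b0 : b != 0.
  apply: contraNneq vi0 => /(congr1 (horner^~ ((c i0)%:C)%C)); rewrite horner0.
  rewrite horner_sum (bigD1 i0) //= [X in _ + X]big1 ?addr0 => [|i ii0].
    rewrite hornerZ horner_prod => /eqP; rewrite mulf_eq0 => /orP[//|].
    rewrite prodf_seq_eq0 => /hasP[l _ /andP[li0]].
    rewrite hornerXsubC subr_eq0 => /eqP/(@complexI R)/cinj e.
    by rewrite e eqxx in li0.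
  by rewrite hornerZ horner_prod (bigD1 i0) 1?eq_sym //= hornerXsubC subrr mul0r mulr0.
have bQ : Q ((map_poly (@mpolyC n C) b).[x]).
  pose W i : S := \prod_(l | l != i) (x - ((c l)%:C)%C%:MP).
  have bx : (map_poly (@mpolyC n C) b).[x] = \sum_i v i *: W i.
    rewrite rmorph_sum horner_sum; apply: eq_bigr => i _.
    rewrite /= map_polyZ hornerZ mul_mpolyC rmorph_prod horner_prod; congr (_ *: _).
    by apply: eq_bigr => l _; rewrite rmorphB /= map_polyX map_polyC hornerXsubC.
  have : Q ((map_poly (@mpolyC n C) b).[x] * G ^+ N).
    have -> : (map_poly (@mpolyC n C) b).[x] * G ^+ N =
        \sum_i (v i *: W i) * (G ^+ N - u i * (x - ((c i)%:C)%C%:MP)).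
      under [RHS]eq_bigr do rewrite mulrBr.
      rewrite sumrB bx mulr_suml.
      have -> : \sum_i v i *: W i * (u i * (x - ((c i)%:C)%C%:MP)) =
          (\prod_l (x - ((c l)%:C)%C%:MP)) * \sum_i v i *: u i.
        rewrite mulr_sumr; apply: eq_bigr => i _.
        rewrite [in RHS](bigD1 i) //= -/(W i) -!mul_mpolyC; ring.
      by rewrite vu mulr0 subr0.
    apply: ideal_sum => // i _; case: (idQ) => _ _; apply; by case: (uP i).
  by case/Qprime => // /QG.
by have [a Qa] := prime_root idQ Q1 Qprime b0 bQ; apply: (nc a).
Qed.

(** An ideal maximal among those containing [J] and missing the powers of [G] is prime, and each
    variable is a constant modulo it; these constants are the coordinates of the point. *)
Theorem nullstellensatz (J : S -> Prop) (G : S) :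
  is_ideal J -> (forall N, ~ J (G ^+ N)) ->
  exists v : 'I_n -> C, (forall p, J p -> p.@[v] = 0) /\ G.@[v] != 0.
Proof.
move=> idJ JG.
have [||| Q [idQ JQ QG Qprime Qmax]] :=
    @prime_avoiding _ (fun s => exists N, s = G ^+ N) J idJ.
- by exists 0; rewrite expr0.
- by move=> _ _ [N ->] [M ->]; exists (N + M)%N; rewrite exprD.
- by move=> _ [N ->].
have {}QG N : ~ Q (G ^+ N) by apply: QG; exists N.
have /choice[v vP] : forall i : 'I_n, exists c, Q ('X_i - c%:MP).
  move=> i; apply: (@maximal_ideal_coordinate Q G 'X_i idQ QG Qprime) => a.
  move=> /Qmax[_ [q [u [[N ->] Qq e]]]]; exists N, u.
  by have -> : G ^+ N - u * a = q by rewrite e addrK.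
have ev p : Q (p - (p.@[v])%:MP).
  elim/mpoly_ring_ind: p => [c|i|p q Qp Qq|p q Qp Qq].
  - by rewrite mevalC subrr; case: idQ.
  - by rewrite mevalXU.
  - by rewrite mevalD mpolyCD opprD addrACA; case: (idQ) => _ QD _; apply: QD.
  - rewrite mevalM mpolyCM.
    have -> : p * q - p.@[v]%:MP * q.@[v]%:MP =
        q * (p - p.@[v]%:MP) + p.@[v]%:MP * (q - q.@[v]%:MP) by ring.
    by case: (idQ) => _ QD QM; apply: QD; apply: QM.
have Q1 : ~ Q 1 by rewrite -(expr0 G).
exists v; split=> [p /JQ Qp|].
  apply/eqP; apply: contrapT => /negP p0; apply: Q1.
  apply: (ideal_unit idQ p0); have := idealB idQ Qp (ev p).
  by rewrite opprB addrC subrK.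
apply/eqP => G0; apply: (QG 1%N); rewrite expr1.
by have := ev G; rewrite G0 mpolyC0 subr0.
Qed.

End Nullstellensatz.

(** * Dimension of homogeneous ideals *)

Section HomogeneousIdeals.
Variables (K : numFieldType) (n : nat).
Notation S := {mpoly K[n]}.
Implicit Types (J P : S -> Prop) (p q a b : S).

Definition homogeneous J := forall p d, J p -> J (pihomog mdeg d p).

Lemma pihomogM_dhomog (u a : S) d e : a \is e.-homog ->
  pihomog mdeg d (u * a) = if (e <= d)%N then pihomog mdeg (d - e) u * a else 0.
Proof.
move=> ha; pose k := maxn (msize u) d.+1.
rewrite {1}(pihomog_partitionE (mf := mdeg) (k := k) (p := u)) ?leq_maxl //.
rewrite mulr_suml raddf_sum /=.
have hom i : pihomog mdeg i u * a \is (i + e).-homog.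
  by apply: dhomogM => //; exact: pihomogP.
case: leqP => [ed|de].
  have dk : (d - e < k)%N by rewrite leq_max orbC; apply/orP; left; lia.
  rewrite (bigD1 (Ordinal dk)) //= big1 ?addr0 => [|i ik].
    by apply: pihomog_dE; have := hom (d - e)%N; rewrite subnK.
  apply: pihomog_ne0 (hom i); apply: contraNneq ik => id; apply/eqP/val_inj.
  by rewrite /= -id addnK.
by rewrite big1 // => i _; apply: pihomog_ne0 (hom i); lia.
Qed.

Lemma homogeneous_add_gen J a e : is_ideal J -> homogeneous J -> a \is e.-homog ->
  homogeneous (add_gen J a).
Proof.
move=> idJ hJ ha _ d [j [u [Jj ->]]].
rewrite raddfD /= (pihomogM_dhomog _ _ ha); case: ifP => _.
  by exists (pihomog mdeg d j), (pihomog mdeg (d - e) u); split => //; exact: hJ.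
by exists (pihomog mdeg d j), 0; rewrite mul0r; split => //; exact: hJ.
Qed.

Definition generated r (F : 'I_r -> S) p := exists w, p = \sum_i w i * F i.

Lemma generated_ideal r (F : 'I_r -> S) : is_ideal (generated F).
Proof.
split.
- by exists (fun=> 0); rewrite big1 // => i _; rewrite mul0r.
- move=> _ _ [v ->] [w ->]; exists (fun i => v i + w i).
  by rewrite -big_split; apply: eq_bigr => i _; rewrite mulrDl.
- move=> a _ [w ->]; exists (fun i => a * w i).
  by rewrite mulr_sumr; apply: eq_bigr => i _; rewrite mulrA.
Qed.

Lemma mem_generated r (F : 'I_r -> S) i : generated F (F i).
Proof.
exists (fun k => (k == i)%:R); rewrite (bigD1 i) //= eqxx mul1r big1 ?addr0 //.
by move=> k /negPf->; rewrite mul0r.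
Qed.

Lemma generated_homogeneous r (F : 'I_r -> S) :
  (forall i, exists e, F i \is e.-homog) -> homogeneous (generated F).
Proof.
move=> hF _ d [w ->]; rewrite raddf_sum /=; apply: ideal_sum => [|i _]; first exact: generated_ideal.
have [e he] := hF i; rewrite (pihomogM_dhomog _ _ he).
have [G0 _ GM] := generated_ideal F; case: ifP => // _; apply: GM; exact: mem_generated.
Qed.

(* In degree N+1, [J] and the linear forms [g] span everything: the common zeros
   of [J] and [g] in projective space are empty. *)
Definition spans J t (g : 'I_t -> S) N := forall m : 'X_{1..n}, mdeg m = N.+1 ->
  exists j u, [/\ J j, forall i, u i \is N.-homog & 'X_[m] = j + \sum_i u i * g i].

(** Projective dimension at least [t]: no [t] linear forms leave an empty zero locus. Each instance
    of [spans] involves finitely many elements of [J], so the condition passes to unions of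
    chains. *)
Definition dim_ge J t := forall (g : 'I_t -> S) N, (forall i, g i \is 1.-homog) -> ~ spans J g N.

Section Pencil.
Variables (J : S -> Prop) (t : nat) (g h : 'I_t -> S) (N : nat).
Hypotheses (idJ : is_ideal J) (hg : forall i, g i \is 1.-homog) (hh : forall i, h i \is 1.-homog).

Let W T x := exists j u, [/\ J j, forall i : 'I_t, u i \is N.-homog &
  x = j + \sum_i u i * (g i + T *: (h i - g i))].

Let W0 T : W T 0.
Proof.
exists 0, (fun=> 0); split => [|i|]; first by case: idJ.
  exact: dhomog0.
by rewrite add0r big1 // => i _; rewrite mul0r.
Qed.

Let WD T x y : W T x -> W T y -> W T (x + y).
Proof.
case=> j [u [Jj hu ->]] [k [v [Jk hv ->]]]; exists (j + k), (fun i => u i + v i); split.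
- by case: idJ => _ JD _; exact: JD.
- by move=> i; exact: rpredD.
- by under [in RHS]eq_bigr do rewrite mulrDl; rewrite big_split addrACA.
Qed.

Let WZ T c x : W T x -> W T (c *: x).
Proof.
case=> j [u [Jj hu ->]]; exists (c *: j), (fun i => c *: u i); split.
- by rewrite -mul_mpolyC; case: idJ => _ _; apply.
- by move=> i; exact: rpredZ.
- by rewrite scalerDr scaler_sumr; under [in RHS]eq_bigr do rewrite -scalerAl.
Qed.

Local Notation I := {: 'X_{1..n < N.+2}}.

(* Modulo [J] and the moved forms, the monomials of degree N+1 satisfy a linear system of the
   shape [1 + T M], which is invertible for almost all [T]. *)
Lemma spans_pencil : spans J g N ->
  exists p : {poly K}, p != 0 /\
    forall T, p.[T] != 0 -> spans J (fun i => g i + T *: (h i - g i)) N.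
Proof.
move=> sp.
have /choice[ju juP] : forall m : 'X_{1..n}, exists ju : S * ('I_t -> S), mdeg m = N.+1 ->
    [/\ J ju.1, forall i, ju.2 i \is N.-homog & 'X_[m] = ju.1 + \sum_i ju.2 i * g i].
  move=> m; have [/eqP/sp[j [u ju]]|/eqP nm] := boolP (mdeg m == N.+1); last by exists (0, fun=> 0).
  by exists (j, u).
pose D (m : I) := \sum_i (ju m).2 i * (h i - g i).
pose top (m : I) := mdeg m == N.+1.
have hD m : top m -> D m \is N.+1.-homog.
  move=> /eqP/juP[_ hu _]; apply: rpred_sum => i _.
  by have := dhomogM (hu i) (rpredB (hh i) (hg i)); rewrite addn1.
pose x (m : I) : S := if top m then 'X_[m] else 0.
(* Rows for monomials of degree other than [N.+1] are 0, so the same rows of [B] are those of the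
   identity. *)
pose M : 'M[K]_#|I| := \matrix_(a, b) if top (enum_val a) then (D (enum_val a))@_(bmnm (enum_val b : I)) else 0.
have Mx (a : 'I_#|I|) : \sum_b M a b *: x (enum_val b) = if top (enum_val a) then D (enum_val a) else 0.
  have -> : \sum_b M a b *: x (enum_val b) =
      \sum_(m : I) (if top (enum_val a) then (D (enum_val a))@_m else 0) *: x m.
    rewrite [RHS](reindex_onto enum_val enum_rank) /= => [|i _]; last by rewrite enum_rankK.
    by apply: eq_big => [b|b _]; rewrite ?enum_valK ?eqxx // mxE.
  case: ifP => [ta|_]; last by rewrite big1 // => m _; rewrite scale0r.
  have hDa := hD _ ta; rewrite [RHS](mpolywE (k := N.+2)); last first.
    rewrite mmeasureE; apply/bigmax_leqP_seq => m ms _.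
    by have := dhomog_mf hDa ms; rewrite /= => ->.
  apply: eq_bigr => m _; rewrite /x; case: ifPn => // tm.
  by rewrite (dhomog_nemf_coeff hDa) // !scale0r.
pose B : 'M[{poly K}]_#|I| := 1%:M + 'X *: map_mx polyC M.
have BT T : \det (1%:M + T *: M) = (\det B).[T].
  rewrite -horner_evalE -det_map_mx; congr (\det _); apply/matrixP => a b.
  by rewrite !mxE rmorphD rmorph_nat rmorphM /= !horner_evalE hornerX hornerC.
exists (\det B); split.
  apply/eqP => B0; have := BT 0; rewrite B0 horner0 scale0r addr0 det1 => /eqP.
  by rewrite oner_eq0.
move=> T; rewrite -BT => dT m mN.
have im : (mdeg m < N.+2)%N by rewrite mN.
have WB (a : 'I_#|I|) : W T (\sum_b (1%:M + T *: M) a b *: x (enum_val b)).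
  under eq_bigr do rewrite mxE [X in X + _]mxE scalerDl [X in _ + X *: _]mxE -scalerA.
  rewrite big_split -scaler_sumr Mx /= (bigD1 a) //= eqxx scale1r big1 ?addr0; last first.
    by move=> b ba; rewrite eq_sym (negPf ba) scale0r.
  rewrite {1}/x; case: ifPn => ta; last by rewrite scaler0 addr0; exact: W0.
  have [Jj hu ->] := juP _ (eqP ta).
  exists (ju (bmnm (enum_val a : I))).1, (ju (bmnm (enum_val a : I))).2; split => //.
  rewrite /D -addrA scaler_sumr -big_split; congr (_ + _); apply: eq_bigr => i _ /=.
  by rewrite [RHS]mulrDr scalerAr.
have : W T ('X_[m]).
  pose a := enum_rank (BMultinom im : I).
  have -> : 'X_[m] = \sum_b (invmx (1%:M + T *: M)) a b *:
      \sum_c (1%:M + T *: M) b c *: x (enum_val c).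
    have U : 1%:M + T *: M \in unitmx by rewrite unitmxE unitfE.
    under eq_bigr do rewrite scaler_sumr; rewrite exchange_big /=.
    under eq_bigr => c _.
      under eq_bigr do rewrite scalerA.
      rewrite -scaler_suml.
      have -> : \sum_b invmx (1%:M + T *: M) a b * (1%:M + T *: M) b c = (a == c)%:R.
        by have := congr1 (fun X : 'M_ _ => X a c) (mulVmx U); rewrite !mxE.
      over.
    rewrite (bigD1 a) //= eqxx scale1r big1 ?addr0; last first.
      by move=> b ba; rewrite eq_sym (negPf ba) scale0r.
    by rewrite /a enum_rankK /x /top /= mN eqxx.
  by apply: big_ind => [|y z|b _]; [exact: W0 | exact: WD | exact: WZ].
by case=> j [u [Jj hu e]]; exists j, u.
Qed.

End Pencil.

(** A monomial of the total degree is a product of two, congruent modulo the [g i] to some [A] in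
    [J + (a)] and some [B] in [J + (b)]; and $AB$ lies in [J] because $ab$ does. *)
Lemma spans_product J a b t (g : 'I_t -> S) N N' : is_ideal J ->
  (forall i, g i \is 1.-homog) -> J (a * b) ->
  spans (add_gen J a) g N -> spans (add_gen J b) g N' -> spans J g (N.+1 + N').
Proof.
move=> idJ hg Jab sa sb m; rewrite -addnS => mN.
have [|m1 [m2 [me m1N]]] := @multinom_split _ m N.+1; first by rewrite mN leq_addr.
have m2N : mdeg m2 = N'.+1 by move: mN; rewrite me mdegD m1N => /addnI.
have [A [u [[j [w [Jj Ae]]] hu e1]]] := sa _ m1N.
have [B [v [[k [z [Jk Be]]] hv e2]]] := sb _ m2N.
have hA : A \is N.+1.-homog.
  have -> : A = 'X_[m1] - \sum_i u i * g i by rewrite e1 addrK.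
  apply: rpredB; first by rewrite dhomogX /= m1N.
  by apply: rpred_sum => i _; rewrite -addn1; exact: dhomogM.
exists (A * B), (fun i => A * v i + u i * 'X_[m2]); split.
- have -> : A * B = B * j + (w * a * k + (w * z) * (a * b)) by rewrite Ae Be; ring.
  by case: idJ => _ JD JM; apply: (JD _ _ (JM _ _ Jj)); apply: (JD _ _ (JM _ _ Jk)); exact: JM.
- move=> i; apply: rpredD; first exact: dhomogM.
  by rewrite addSnnS; apply: dhomogM => //; rewrite dhomogX /= m2N.
- under eq_bigr do rewrite mulrDl -mulrA [X in _ + X]mulrAC.
  rewrite big_split -mulr_sumr -mulr_suml /= me mpolyXD {1}e1 mulrDl addrA; congr (_ + _).
  by rewrite e2 mulrDr.
Qed.

(** The pencil from [g] to [h] at [T] is the pencil from [h] to [g] at [1 - T]; each excludes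
    finitely many parameters, and the field is infinite. *)
Lemma poly_common_nonroot (p q : {poly K}) : p != 0 -> q != 0 ->
  exists T, p.[T] != 0 /\ q.[1 - T] != 0.
Proof.
move=> p0 q0; pose r := p * (q \Po (1 - 'X)).
have r0 : r != 0.
  rewrite mulf_neq0 // -size_poly_eq0 size_comp_poly2 ?size_poly_eq0 //.
  by rewrite -opprB size_polyN size_XsubC.
have [T Tr] : exists T, ~~ root r T.
  apply: contrapT => /forallNP nr; pose s := [seq (i%:R : K) | i <- iota 0 (size r)].
  have us : uniq s.
    by rewrite map_inj_uniq ?iota_uniq // => i k /eqP; rewrite eqr_nat => /eqP.
  have /negP[] : ~~ (size s < size r)%N by rewrite size_map size_iota ltnn.
  apply: max_poly_roots => //; apply/allP => x _.
  by apply: contrapT => /negP; exact: nr.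
move: Tr; rewrite /root /r hornerM horner_comp mulf_eq0 negb_or !hornerE => /andP[].
by exists T.
Qed.

(* If adding [a] or [b] to [P] lowers the dimension, witnessed by linear forms [g] and [h]
   respectively, then a general member of the pencil of [g] and [h] is a witness for both. *)
Lemma maximal_dim_ge J t : is_ideal J -> homogeneous J -> dim_ge J t ->
  exists P, [/\ is_ideal P, homogeneous P, dim_ge P t, forall x, J x -> P x &
    forall a b d e, a \is d.-homog -> b \is e.-homog -> P (a * b) -> P a \/ P b].
Proof.
move=> idJ hJ dJ.
have [||P [idP [hP dP] JP Pmax]] :=
    @maximal_ideal _ (fun X => homogeneous X /\ dim_ge X t) J idJ.
- by split.
- move=> F [X0 FX0] FP tot; split.
    by move=> p d [X [FX Xp]]; exists X; split => //; case: (FP _ FX) => _ [hX _]; exact: hX.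
  move=> g N hg sp.
  (* Finitely many monomials have degree [N.+1], so a single member of the chain contains all the
     witnesses. *)
  have fin (s : seq 'X_{1..n}) : (forall m, m \in s -> mdeg m = N.+1) ->
      exists X, F X /\ forall m, m \in s ->
        exists j u, [/\ X j, forall i : 'I_t, u i \is N.-homog & 'X_[m] = j + \sum_i u i * g i].
    elim: s => [|m s IH] ms; first by exists X0.
    have [|X [FX XP]] := IH; first by move=> m' m's; apply: ms; rewrite inE m's orbT.
    have [|j [u [[Y [FY Yj]] hu e]]] := sp m; first by rewrite ms // inE eqxx.
    case: (tot _ _ FX FY) => [XY|YX].
      exists Y; split => // m'; rewrite inE => /orP[/eqP->|/XP[j' [u' [Xj' hu' e']]]].
        by exists j, u.
      by exists j', u'; split => //; exact: XY.
    exists X; split => // m'; rewrite inE => /orP[/eqP->|/XP//].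
    by exists j, u; split => //; exact: YX.
  have [|X [FX XP]] := fin [seq val m | m <- enum {: 'X_{1..n < N.+2}} & mdeg (val m) == N.+1].
    by move=> _ /mapP[m + ->]; rewrite mem_filter => /andP[/eqP].
  case: (FP _ FX) => _ [_ dX]; apply: (dX g N hg) => m mN; apply: XP.
  have im : (mdeg m < N.+2)%N by rewrite mN.
  by apply/mapP; exists (BMultinom im); rewrite // mem_filter mem_enum /= mN eqxx.
exists P; split => // a b d e ha hb Pab; apply: contrapT => /not_orP[nPa nPb].
have fail c f : c \is f.-homog -> ~ P c ->
    exists g N, (forall i : 'I_t, g i \is 1.-homog) /\ spans (add_gen P c) g N.
  move=> hc /Pmax nP; apply: contrapT => nh; apply: nP; split.
    exact: homogeneous_add_gen hc.
  by move=> g N hg' sp; apply: nh; exists g, N.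
have [g [N [hg sa]]] := fail _ _ ha nPa; have [h [N' [hh sb]]] := fail _ _ hb nPb.
have [p [p0 pP]] := spans_pencil (ideal_add_gen a idP) hg hh sa.
have [q [q0 qP]] := spans_pencil (ideal_add_gen b idP) hh hg sb.
have [T [pT qT]] := poly_common_nonroot p0 q0.
have hgT i : g i + T *: (h i - g i) \is 1.-homog.
  by apply: rpredD => //; apply: rpredZ; exact: rpredB.
apply: (dP _ _ hgT); apply: (spans_product idP hgT Pab (pP _ pT)).
have := qP _ qT; congr (spans _ _ _); apply/funext => i.
by rewrite scalerBl scale1r -[in RHS]opprB scalerN; rewrite addrA subrKC //.
Qed.

(** Linear forms that are too many for [J + (x)] become too many for [J] once [x] joins them;
    homogeneous components are taken because the parts in [J] and along [x] need not be
    homogeneous. *)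
Lemma dim_ge_cut J x t : is_ideal J -> homogeneous J -> dim_ge J t.+1 -> x \is 1.-homog ->
  dim_ge (add_gen J x) t.
Proof.
move=> idJ hJ dJ hx g N hg sp.
pose g' (i : 'I_t.+1) := if unlift ord0 i is Some k then g k else x.
apply: (dJ g' N) => [i|m mN]; first by rewrite /g'; case: unlift.
have [A [u [[j [w [Jj Ae]]] hu e]]] := sp _ mN.
have hA : A \is N.+1.-homog.
  have -> : A = 'X_[m] - \sum_i u i * g i by rewrite e addrK.
  apply: rpredB; first by rewrite dhomogX /= mN.
  by apply: rpred_sum => i _; rewrite -addn1; exact: dhomogM.
exists (pihomog mdeg N.+1 j), (fun i => if unlift ord0 i is Some k then u k else pihomog mdeg N w).
split.
- exact: hJ.
- by move=> i; case: unlift => [k|] //; exact: pihomogP.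
- rewrite big_ord_recl /g' unlift_none.
  under [in RHS]eq_bigr do rewrite liftK.
  rewrite addrA e -(pihomog_dE hA) Ae raddfD /= (pihomogM_dhomog _ _ hx) /=.
  by rewrite subn1.
Qed.

(** If all variables were in [P], degree 1 would be spanned even with zero linear forms. This
    excludes the irrelevant ideal. *)
Lemma dim_ge_coordinate P t : dim_ge P t -> is_ideal P -> exists i, ~ P 'X_i.
Proof.
move=> dP idP; apply: contrapT => /forallNP h.
apply: (dP (fun=> 0) 0%N) => [i|m /eqP]; first exact: dhomog0.
move=> /mdeg1P[i /eqP->]; exists 'X_i, (fun=> 0); split => [|k|].
- exact: contrapT.
- exact: dhomog0.
- by rewrite big1 ?addr0 // => k _; rewrite mulr0.
Qed.

(** The [r] forms and the [t] linear forms are together fewer than the variables, so by counting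
    they cannot generate all monomials of some degree. *)
Lemma dim_ge_generated r t (F : 'I_r -> S) : (r + t < n)%N ->
  (forall i, exists e, (0 < e)%N /\ F i \is e.-homog) -> dim_ge (generated F) t.
Proof.
move=> rtn hF g N hg sp.
pose H (i : 'I_(r + t)) := match fintype.split i with inl k => F k | inr k => g k end.
apply: (@few_forms_contradiction K n (r + t) H N.+1 rtn) => [i|m mN].
  rewrite /H; case: fintype.split => k; last exact: dhomog_vanishes_to.
  have [e [e0 /dhomog_vanishes_to he]] := hF k.
  by move=> m m1; apply: he; exact: leq_trans m1 e0.
have [_ [u [[w ->] _ ->]]] := sp _ mN.
exists (fun i => match fintype.split i with inl k => w k | inr k => u k end).
rewrite big_split_ord; congr (_ + _); apply: eq_bigr => k _; rewrite /H.
  by rewrite (unsplitK (inl k) : fintype.split (lshift t k) = _).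
by rewrite (unsplitK (inr k) : fintype.split (rshift r k) = _).
Qed.

(** Enlarge [J] to a maximal [Q] with [dim_ge], which is prime for forms, add a variable outside it
    and recurse. The ideals decrease with the index so that their zero sets increase, and a variable
    witnesses each strict step. *)
Lemma prime_chain J t : is_ideal J -> homogeneous J -> dim_ge J t ->
  exists P : nat -> S -> Prop,
  (forall i, (i <= t)%N -> [/\ is_ideal (P i), forall x, J x -> P i x, exists k, ~ P i 'X_k &
     forall a b d e, a \is d.-homog -> b \is e.-homog -> P i (a * b) -> P i a \/ P i b]) /\
  (forall i, (i < t)%N -> (forall x, P i.+1 x -> P i x) /\ exists k, P i 'X_k /\ ~ P i.+1 'X_k).
Proof.
elim: t J => [|t IH] J idJ hJ /(maximal_dim_ge idJ hJ)[Q [idQ hQ dQ JQ primeQ]];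
  have [k Qk] := dim_ge_coordinate dQ idQ.
  by exists (fun=> Q); split => // i _; split => //; exists k.
have hX : ('X_k : S) \is 1.-homog by rewrite dhomogX /= mdeg1.
have [P [Pprime Pchain]] := IH _ (ideal_add_gen 'X_k idQ) (homogeneous_add_gen idQ hQ hX)
  (dim_ge_cut idQ hQ dQ hX).
exists (fun i => if (i <= t)%N then P i else Q); split.
  move=> i it; case: leqP => [/Pprime[idP QP Pk primeP]|_]; last by split => //; exists k.
  by split => // x /JQ Qx; apply: QP; exact: sub_add_gen.
move=> i; rewrite ltnS => it; rewrite it; case: ltnP => [/Pchain//|ti].
have [_ QP _ _] := Pprime _ it; split.
  by move=> x Qx; apply: QP; exact: sub_add_gen.
exists k; split => //; apply: QP; apply: mem_add_gen; by case: idQ.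
Qed.

End HomogeneousIdeals.

(** * Singular locus and multiplicity of destabilized hypersurfaces *)

Section ProjectiveDimension.
Variables (R : realType) (n : nat).
Notation C := (R[i]).
Notation S := {mpoly C[n.+1]}.

(** The chain consists of the zero sets of the primes of [prime_chain]. By the Nullstellensatz a
    form outside a prime is nonzero somewhere on its zero set: this gives nonemptiness, strictness
    and, for a product of two forms, irreducibility. *)
Lemma irr_chain_common_zeros r t (F : 'I_r -> S) (X : vec R n -> Prop) : (r + t <= n)%N ->
  (forall i, exists e, (0 < e)%N /\ F i \is e.-homog) ->
  (forall v, nonzero v -> (forall i, (F i).@[v] = 0) -> X v) -> irr_chain X t.
Proof.
move=> rtn hF FX.
have hom : homogeneous (generated F).
  by apply: generated_homogeneous => i; have [e [_ he]] := hF i; exists e.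
have [P [Pprime Pchain]] := prime_chain (generated_ideal F) hom (dim_ge_generated (rtn : (r + t < n.+1)%N) hF).
pose form (p : S) := exists d, p \is d.-homog.
pose Z i (v : vec R n) := nonzero v /\ forall p, P i p /\ form p -> p.@[v] = 0.
have formX k : form 'X_k by exists 1%N; rewrite dhomogX /= mdeg1.
have formM p q : form p -> form q -> form (p * q).
  by move=> [a ha] [b hb]; exists (a + b)%N; exact: dhomogM.
have primeM i p q : (i <= t)%N -> form p -> form q -> ~ P i p -> ~ P i q -> ~ P i (p * q).
  by move=> /Pprime[_ _ _ pr] [a ha] [b hb] np nq /(pr _ _ _ _ ha hb)[].
have proper i : (i <= t)%N -> ~ P i 1.
  move=> /Pprime[[_ _ PM] _ [k nk] _] P1; apply: nk.
  by rewrite -[X in P i X]mulr1; exact: PM.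
have generic i G : (i <= t)%N -> form G -> ~ P i G -> exists v, Z i v /\ G.@[v] != 0.
  move=> it fG nG; have [idP _ [k nk] _] := Pprime i it.
  (* The factor ['X_k] keeps the point away from the origin. *)
  have fGk := formM _ _ fG (formX k).
  have nGk := primeM _ _ _ it fG (formX k) nG nk.
  have [N|v [Pv Gv]] := nullstellensatz (G := G * 'X_k) idP.
    suff: form ((G * 'X_k) ^+ N) /\ ~ P i ((G * 'X_k) ^+ N) by case.
    elim: N => [|N [fN nN]]; rewrite ?expr0 ?exprS.
      by split; [exists 0%N; exact: dhomog1 | exact: proper].
    by split; [exact: formM | exact: primeM].
  move: Gv; rewrite mevalM mevalXU mulf_eq0 negb_or => /andP[Gv vk].
  by exists v; split => //; split; [exists k | move=> p [/Pv]].
exists Z; split=> [i it|i it]; last first.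
  have [sub [k [Pk nPk]]] := Pchain i it; split.
    by move=> v [v0 vP]; split => // p [/sub Pp fp]; exact: vP.
  have [v [Zv vk]] := generic _ _ it (formX k) nPk; exists v; split => // -[_ vP].
  by move: vk; rewrite vP ?eqxx.
have [_ JP _ _] := Pprime i it.
split; last first.
  move=> v [v0 vP]; apply: FX => // k; apply: vP; split; first by apply: JP; exact: mem_generated.
  by have [e [_ he]] := hF k; exists e.
split.
  by exists (fun p => P i p /\ form p); split => // p [_ [e he]]; exists e.
split.
  have [||v [Zv _]] := @generic i 1 it; last by exists v.
  - by exists 0%N; exact: dhomog1.
  - exact: proper.
move=> Y Y' [Fam [Famf YE]] [Fam' [Famf' YE']] _ _ cov.
apply: contrapT => /not_orP[/existsNP[v /not_implyP[Zv nYv]] /existsNP[v' /not_implyP[Zv' nYv']]].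
have sep W (Fm : S -> Prop) w : (forall u, W u <-> nonzero u /\ forall p, Fm p -> p.@[u] = 0) ->
    (forall p, Fm p -> form p) -> Z i w -> ~ W w -> exists p, [/\ Fm p, form p & ~ P i p].
  move=> WE Ff [w0 wP] nW; apply: contrapT => /forallNP h; apply: nW; apply/WE; split => // p Fp.
  apply: wP; split; last exact: Ff.
  by apply: contrapT => nP; apply: (h p); split => //; exact: Ff.
have [p [Fp fp np]] := sep _ _ _ YE Famf Zv nYv.
have [q [Fq fq nq]] := sep _ _ _ YE' Famf' Zv' nYv'.
have [u [Zu]] := generic _ _ it (formM _ _ fp fq) (primeM _ _ _ it fp fq np nq).
rewrite mevalM; case: (cov _ Zu) => [/YE[_ /(_ _ Fp) ->]|/YE'[_ /(_ _ Fq) ->]].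
  by rewrite mul0r eqxx.
by rewrite mulr0 eqxx.
Qed.

End ProjectiveDimension.

Lemma meval_scale (A : comNzRingType) n (p : {mpoly A[n]}) d c v : p \is d.-homog ->
  p.@[fun i => c * v i] = c ^+ d * p.@[v].
Proof.
move=> hp; rewrite !mevalE mulr_sumr big_seq [RHS]big_seq; apply: eq_bigr => m mp.
under eq_bigr do rewrite exprMn.
by rewrite big_split /= -expr_sum -(dhomog_mf hp mp) /= mdegE mulrCA.
Qed.

(** * Singular points and multiplicity in destabilizing coordinates *)

Section DestabilizedGeometry.
Variables (R : realType) (n d : nat) (f : {mpoly R[i][n.+1]}).
Notation C := (R[i]).
Notation N := n.+1.
Variables (k k' : 'M[C]_N) (V : zmodType) (lam : 'I_N -> V) (pos : V -> Prop).
Hypotheses (homf : f \is d.-homog) (d3 : (3 <= d)%N).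
Hypotheses (kk' : k *m k' = 1%:M) (k'k : k' *m k = 1%:M) (ow : ordered_weights lam pos).

Let f1 := lin_subst k f.
Hypothesis f1pos : forall m, m \in msupp f1 -> pos (\sum_i lam i *+ m i).

Let fE : f = lin_subst k' f1.
Proof. by rewrite lin_subst_mul kk' lin_subst1. Qed.

Let homf1 : f1 \is d.-homog. Proof. exact: dhomog_lin_subst. Qed.

Let pos0 : pos 0. Proof. by case: (pos_total ow 0); rewrite ?oppr0. Qed.

Let posMn x e : pos x -> pos (x *+ e).
Proof. by move=> px; elim: e => [|e IH]; rewrite ?mulr0n // mulrS; apply: (pos_add ow). Qed.

(** Only variables of index at most [a] occur in such a monomial, each of weight at most [lam a]. *)
Let monomial_weight (w : 'I_N -> C) (a : 'I_N) (m : 'X_{1..N}) :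
  (forall i : 'I_N, (a < i)%N -> w i = 0) -> \prod_i w i ^+ m i != 0 ->
  pos (lam a *+ mdeg m - \sum_i lam i *+ m i).
Proof.
move=> wa /prodf_neq0 wm; rewrite mdegE -sumrMnr -sumrB.
apply: big_ind => // [|i _]; first exact: (pos_add ow).
have [ia|ai] := leqP i a; first by rewrite -mulrnBl; apply: posMn; exact: (weights_sorted ow).
have := wm i isT; rewrite wa // expr0n; case: (m i) => [|e]; rewrite ?eqxx //.
by rewrite !mulr0n subrr.
Qed.

Let f1_vanishes (w : 'I_N -> C) (a : 'I_N) : ~ pos (lam a) ->
  (forall i : 'I_N, (a < i)%N -> w i = 0) -> f1.@[w] = 0.
Proof.
move=> na wa; rewrite mevalE big_seq big1 // => m mf1.
have [->|wm] := eqVneq (\prod_i w i ^+ m i) 0; first by rewrite mulr0.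
case: na; apply: (@pos_saturated _ _ _ _ ow _ d.-1); rewrite prednK; last by lia.
have := pos_add ow (monomial_weight wa wm) (f1pos mf1).
by rewrite subrK (dhomog_mf homf1 mf1 : mdeg m = d).
Qed.

Lemma singular_weights s : ~ irr_chain (Hsing f) s.+1 ->
  forall a l : 'I_N, (s < a)%N -> (l = n.+1 + s - a :> nat)%N -> ~ pos (lam a) ->
    pos (lam l + lam a *+ (d - 1)).
Proof.
move=> nchain a l sa la na; apply: contrapT => npos; apply: nchain.
(* As $a+l=n+1+s$, there are $n-s-1$ forms, which leaves room for a chain of length [s.+1]. They are
   pulled back by [k'] to the original coordinates. *)
pose F (i : 'I_((n - a) + (n - l))) : {mpoly C[N]} := match fintype.split i with
  | inl i => lin_subst k' 'X_(inord (a.+1 + i))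
  | inr i => lin_subst k' (mderiv (inord (l.+1 + i)) f1) end.
have aN := ltn_ord a.
have Fa (i : 'I_N) : (a < i)%N -> exists x, F x = lin_subst k' 'X_i.
  move=> ai; have lt : (i - a.+1 < n - a)%N by have := ltn_ord i; lia.
  exists (lshift _ (Ordinal lt)); rewrite /F (unsplitK (inl (Ordinal lt)) : fintype.split (lshift _ _) = _).
  by congr (lin_subst k' 'X_ _); apply/val_inj; rewrite /= subnKC // inordK.
have Fl (i : 'I_N) : (l < i)%N -> exists x, F x = lin_subst k' (mderiv i f1).
  move=> li; have lt : (i - l.+1 < n - l)%N by have := ltn_ord i; lia.
  exists (rshift _ (Ordinal lt)); rewrite /F (unsplitK (inr (Ordinal lt)) : fintype.split (rshift _ _) = _).
  by congr (lin_subst k' (mderiv _ f1)); apply/val_inj; rewrite /= subnKC // inordK.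
have homd i : mderiv i f1 \is (d - 1).-homog.
  apply/dhomogP => m; rewrite mcoeff_msupp mcoeff_mderiv => nz /=.
  have : (m + U_(i))%MM \in msupp f1.
    by rewrite mcoeff_msupp; apply: contraNneq nz => ->; rewrite mul0rn.
  by move/(dhomog_mf homf1); rewrite /= mdegD mdeg1 => <-; rewrite addnK.
apply: (irr_chain_common_zeros (F := F)); first by have := ltn_ord l; lia.
  move=> i; rewrite /F; case: fintype.split => x.
    by exists 1%N; split => //; apply: dhomog_lin_subst; rewrite dhomogX /= mdeg1.
  by exists (d - 1)%N; split; [lia | apply: dhomog_lin_subst].
move=> v v0 vF; pose w (i : 'I_N) := \sum_j k' i j * v j.
have wa (i : 'I_N) : (a < i)%N -> w i = 0.
  by move=> /Fa[x Fx]; have := vF x; rewrite Fx meval_lin_subst mevalXU.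
have dw i : (mderiv i f1).@[w] = 0.
  (* For [i] at most [l], a monomial of the derivative that is nonzero at [w] would come from a
     monomial of [f1] of weight at most [lam l + lam a *+ (d - 1)], which is negative. *)
  have [il|/Fl[x Fx]] := leqP i l; last by have := vF x; rewrite Fx meval_lin_subst.
  rewrite mevalE big_seq big1 // => m mi.
  have [->|wm] := eqVneq (\prod_i w i ^+ m i) 0; first by rewrite mulr0.
  have mf1 : (m + U_(i))%MM \in msupp f1.
    move: mi; rewrite !mcoeff_msupp mcoeff_mderiv; apply: contraNneq => ->.
    by rewrite mul0rn.
  case: npos; have := f1pos mf1.
  have -> : \sum_j lam j *+ (m + U_(i))%MM j = \sum_j lam j *+ m j + lam i.
    under eq_bigr do rewrite mnmDE mnm1E mulrnDr.
    rewrite big_split; congr (_ + _).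
    by rewrite (bigD1 i) //= eqxx big1 ?addr0 // => j; rewrite eq_sym => /negPf->.
  move=> /(pos_add ow (pos_add ow (monomial_weight wa wm) (weights_sorted ow il))).
  rewrite addrA [X in X + _ + _]addrAC subrK -addrA subrK addrC.
  by rewrite (dhomog_mf (homd i) mi : mdeg m = _).
split.
  by split => //; rewrite fE meval_lin_subst; apply: (f1_vanishes na wa).
move=> i; rewrite fE mderiv_lin_subst raddf_sum big1 // => j _ /=.
by rewrite mevalZ meval_lin_subst dw mulr0.
Qed.

(** At the point with new coordinates $[1:0:\dots:0]$ all new coordinates but the first vanish, so a
    monomial [m] of [f1] contributes order at least [mdeg m - m ord0]. If all these exceeded
    [delta], so would the multiplicity there. *)
Lemma multiplicity_monomial delta : f != 0 -> max_mult f delta ->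
  exists2 m, m \in msupp f1 & (mdeg m - m ord0 <= delta)%N.
Proof.
move=> f0 [_ maxm]; pose v : vec R n := fun i => k i ord0.
have k'v i : \sum_j k' i j * v j = (i == ord0)%:R.
  by have := congr1 (fun X : 'M_N => X i ord0) k'k; rewrite !mxE.
have [i0 vi0] : nonzero v.
  apply: contrapT => /forallNP h; have := k'v ord0; rewrite big1 => [/eqP|j _].
    by rewrite eqxx eq_sym oner_eq0.
  by move/negP/negPn/eqP: (h j) => ->; rewrite mulr0.
have onv : onH f v.
  split; first by exists i0.
  rewrite fE meval_lin_subst; apply: (f1_vanishes (weights_neg ow)) => i i_gt0.
  by rewrite k'v; case: eqP i_gt0 => [->|].
have [T [locE TE]] : exists T : N.-tuple {mpoly C[N]}, local_eq f v i0 = f \mPo T /\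
    forall j, tnth T j = (v j / v i0)%:MP + (if j == i0 then 0 else 'X_j).
  eexists; split; first by rewrite /local_eq; reflexivity.
  by move=> j; rewrite tnth_mktuple; reflexivity.
(* By homogeneity the local equation determines [f] where coordinate [i0] is nonzero, so it is
   nonzero and has a lowest degree. *)
have loc0 : f \mPo T != 0.
  apply: contraNneq f0 => fT0.
  have fz (z : 'I_N -> C) : z i0 != 0 -> f.@[z] = 0.
    move=> z0; pose y (j : 'I_N) := z j / z i0 - v j / v i0.
    have : (f \mPo T).@[y] = 0 by rewrite fT0 meval0.
    rewrite comp_mpoly_meval => fy.
    rewrite -[RHS](mulr0 (z i0 ^+ d)) -fy -(meval_scale _ _ homf); apply: meval_eq => j.
    rewrite TE mevalD mevalC; case: eqP => [->|_].
      rewrite meval0 addr0 (divff vi0); exact: esym (mulr1 _).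
    rewrite mevalXU /y addrC subrK mulrC; exact: esym (divfK z0 _).
  apply: contrapT => fn0.
  have [||u [_]] := @nullstellensatz R N (fun p => p = 0) ('X_i0 * f).
  - split; [exact: erefl | move=> x y -> ->; exact: addr0 | move=> a x ->; exact: mulr0].
  - move=> e; apply/eqP; apply: expf_neq0; apply: mulf_neq0; last exact/negP.
    by rewrite -msupp_eq0 msuppX.
  rewrite mevalM mevalXU mulf_eq0 negb_or => /andP[u0].
  by rewrite fz ?eqxx.
apply: contrapT => /forall2NP nomon.
have locv : vanishes_to delta.+1 (f \mPo T).
  (* [q i] is the [i]-th new coordinate read in the chart centered at [v]. *)
  pose q i := lin_subst k' 'X_i \mPo T.
  have comp p : lin_subst k' p \mPo T = p \mPo [tuple q i | i < N].
    apply: (@mpoly_rmorph_ext _ _ _ (comp_mpoly T \o lin_subst k') (comp_mpoly [tuple q i | i < N])) => [c|i] /=.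
      by rewrite lin_substC !comp_mpolyC.
    rewrite [RHS]comp_mpolyXU -[RHS]tnth_nth tnth_mktuple; exact: erefl.
  rewrite fE comp comp_mpolyE big_seq; apply: vanishes_to_sum => m mf1; apply: vanishes_toZ.
  under eq_bigr do rewrite tnth_mktuple.
  have qv i : vanishes_to (i != ord0) (q i).
    have [->|i_neq0] := eqVneq i ord0; first exact: vanishes_to_any.
    move=> m'; rewrite ltnS leqn0 mdeg_eq0 => /eqP ->.
    rewrite /q lin_substX (raddf_sum (comp_mpoly T)) (raddf_sum (mcoeff 0%MM)) /=.
    under eq_bigr do rewrite comp_mpolyZ mcoeffZ comp_mpolyXU -tnth_nth TE mcoeffD mcoeffC eqxx mulr1.
    rewrite -[RHS](mul0r (v i0)^-1) -[X in X / _](_ : (i == ord0)%:R = 0); last by rewrite (negPf i_neq0).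
    rewrite -k'v mulr_suml; apply: eq_bigr => j _.
    by case: eqP => _; rewrite ?mcoeff0 ?mcoeffX ?mnm1_eq0 addr0 mulrA.
  have vp := @vanishes_to_prod _ _ _ q (fun i => (i != ord0) : nat) (fun i => m i) qv.
  move=> m' m'd; apply: vp; apply: (leq_trans m'd).
  have h : (delta < mdeg m - m ord0)%N.
    by rewrite ltnNge; apply/negP => le; case: (nomon m); apply.
  apply: (leq_trans h).
  rewrite mdegE big_ord_recl addnC addnK [X in (_ <= X)%N]big_ord_recl mul0n add0n.
  by apply: leq_sum => i _; rewrite mul1n.
have exm : exists e, has (fun m => mdeg m == e) (msupp (f \mPo T)).
  move: loc0; rewrite -msupp_eq0; move: (msupp (f \mPo T)) => [|m ms] h; first by rewrite eqxx in h.
  by exists (mdeg m); rewrite /= eqxx.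
case: (ex_minnP exm) => e /hasP[m mT /eqP me] emin.
have : (e <= delta)%N.
  apply: (maxm v i0 e onv); split; first exact: vi0.
  rewrite locE; split; first by exists m; split; [exact: mT | exact: me].
  by move=> m' m'T; apply: emin; apply/hasP; exists m'; [exact: m'T | exact: eqxx].
move=> ed; have md : (mdeg m < delta.+1)%N by rewrite me.
by rewrite mcoeff_msupp (locv m md) eqxx in mT.
Qed.

End DestabilizedGeometry.

(** * The numerical bounds *)

Section Criterion.
Variables (R : realType) (n d : nat) (f : {mpoly R[i][n.+1]}) (s delta : nat).
Hypotheses (homf : f \is d.-homog) (f0 : f != 0) (d3 : (3 <= d)%N).
Hypotheses (dimf : pdim (Hsing f) s) (multf : max_mult f delta).

Lemma not_semistable_destabilized : ~ semistable d f -> destabilized True f.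
Proof.
move=> /contrapT cl; have [|k [k' [V [lam [pos [? ? ? ? h]]]]]] := zclosure_destabilized homf cl.
  move=> [g [detg /esym e]]; case/eqP: f0; move: e; rewrite /in_SL in detg.
  rewrite -[act g f]/(lin_subst g f) => e.
  have U : g \in unitmx by rewrite unitmxE detg unitr1.
  by rewrite -[f]lin_subst1 -(mulmxV U) -lin_subst_mul e rmorph0.
by exists k, k', V, lam, pos; split => // _; exact: h.
Qed.

Lemma not_stable_destabilized : ~ stable d f -> destabilized False f.
Proof.
move=> /not_andP[/existsNP[h /not_implyP[cl norb]]|]; last exact: (infinite_stabilizer_destabilized homf).
have [k [k' [V [lam [pos [? ? ? ? _]]]]]] := zclosure_destabilized homf cl norb.
by exists k, k', V, lam, pos; split.
Qed.

Lemma destabilized_multiplicity (strict : Prop) : destabilized strict f ->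
  ((s < n)%N -> (d * (d - 2) <= delta * ((d - 1) * s.+1 + (d - 2)))%N /\
     (strict -> (d * (d - 2) < delta * ((d - 1) * s.+1 + (d - 2)))%N)) /\
  ((d <= delta * n.+1)%N /\ (strict -> (d < delta * n.+1)%N)).
Proof.
move=> [k [k' [V [lam [pos [kk' k'k ow f1pos f1strict]]]]]].
have [m mf1 mdelta] := multiplicity_monomial homf d3 kk' k'k ow f1pos f0 multf.
have md : mdeg m = d := dhomog_mf (dhomog_lin_subst k homf) mf1.
have m0 : (m ord0 <= d)%N by rewrite -md mdegE big_ord_recl leq_addr.
rewrite md in mdelta.
split=> [sn|].
  have sing := singular_weights homf d3 kk' ow f1pos (proj2 dimf).
  have top := singular_weight_bound ow sn (ltnW d3) sing.
  have e0 : (0 < d - 2)%N by lia.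
  have [le lt] := weight_multiplicity_bound ow e0 top (f1pos _ mf1).
  rewrite md in le lt; split=> [|st]; [move: le | move: (lt (f1strict st _ mf1))]; nia.
(* Here the weight bound has constants [n] and 1, whence $d\le\delta(n+1)$. *)
have := top_weight_bound ow; rewrite -[lam ord_max]mulr1n => top.
have [le lt] := weight_multiplicity_bound ow (isT : (0 < 1)%N) top (f1pos _ mf1).
rewrite md in le lt; split=> [|st]; [move: le | move: (lt (f1strict st _ mf1))]; nia.
Qed.

End Criterion.

Theorem theorem2p1 (R : realType) (n d : nat) (f : {mpoly R[i][n.+1]})
  (s delta : nat) :
  (2 <= n)%N -> (3 <= d)%N ->
  f != 0 -> f \is d.-homog ->
  (exists v, Hsing f v) ->
  pdim (Hsing f) s ->
  max_mult f delta ->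
  ((s <= n - 2)%N ->
     let b : R := (d%:R * (d%:R - 2)) / ((s%:R + 2) * d%:R - (s%:R + 3)) in
     (delta%:R < b -> stable d f) /\ (delta%:R <= b -> semistable d f)) /\
  ((s = n - 1)%N ->
     let b : R := d%:R / (n%:R + 1) in
     (delta%:R < b -> stable d f) /\ (delta%:R <= b -> semistable d f)).
Proof.
move=> n2 d3 f0 homf _ dimf multf.
have nst : ~ stable d f -> destabilized False f := not_stable_destabilized homf.
have nss : ~ semistable d f -> destabilized True f := not_semistable_destabilized homf f0.
have bound st := destabilized_multiplicity homf f0 d3 dimf multf (strict := st).
split=> [sn b|_ b].
  have sn' : (s < n)%N by lia.
  have den : (((d - 1) * s.+1 + (d - 2))%N%:R : R) = (s%:R + 2) * d%:R - (s%:R + 3).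
    by rewrite natrD natrM !natrB ?(leq_trans _ d3) // -natr1; ring.
  have num : ((d * (d - 2))%N%:R : R) = d%:R * (d%:R - 2).
    by rewrite natrM natrB // (leq_trans _ d3).
  have den0 : 0 < (s%:R + 2) * d%:R - (s%:R + 3) :> R.
    by rewrite -den ltr0n addn_gt0 orbC subn_gt0 d3.
  split=> lt; apply: contrapT.
    move=> /nst/bound[/(_ sn')[le _] _]; move: lt; rewrite /b ltr_pdivlMr // -num -den -natrM ltr_nat.
    by rewrite ltnNge le.
  move=> /nss/bound[/(_ sn')[_ /(_ I) le] _]; move: lt; rewrite /b ler_pdivlMr // -num -den -natrM ler_nat.
  by rewrite leqNgt le.
have den : (n.+1%:R : R) = n%:R + 1 by rewrite -natr1.
split=> lt; apply: contrapT.
  move=> /nst/bound[_ [le _]]; move: lt; rewrite /b -den ltr_pdivlMr ?ltr0n // -natrM ltr_nat.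
  by rewrite ltnNge le.
move=> /nss/bound[_ [_ /(_ I) le]]; move: lt; rewrite /b -den ler_pdivlMr ?ltr0n // -natrM ler_nat.
by rewrite leqNgt le.
Qed.
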